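(* Let $R>\hat R:=16\,e^{(4e)^{-1}}$ and $T>0$. Then there exists a number $\hat C>0$ such that for all functions $y^0,\widetilde y^0\in\mathcal R_{R,\hat C}$ which are odd with respect to $0$, there exist functions $y\in G^{1,4}([0,1]\times[0,T])$ and $v,w\in G^4([0,T])$ satisfying $$\partial_ty=-\partial_x^4y-\partial_x^2y-y\,\partial_xy,\quad x\in[0,1],\ t\in[0,T],$$ $$y(0,t)=0,\quad y(1,t)=v(t),\quad \partial_x^2y(0,t)=0,\quad \partial_x^2y(1,t)=w(t),\quad t\in[0,T],$$ $$y(x,0)=y^0(x),\quad x\in[0,1],$$ together with $y(x,T)=\widetilde y^0(x)$ for all $x\in[0,1]$.
   Context: All functions are real-valued. $\mathcal R_{R,C}$ ($R>1$, $C>0$): functions $z$ on $[-1,1]$ for which there is a sequence $(\alpha_n)_{n\ge0}$ with $|\alpha_n|\le C\,n!/R^n$ for all $n$ and $z(x)=\sum_{n\ge0}\alpha_nx^n/n!$ for all $x\in[-1,1]$. Gevrey classes: $h\in G^s([t_1,t_2])$ if $h\in C^\infty$ and $|h^{(p)}(t)|\le C(p!)^s/R^p$ for some $C,R>0$ and all $p\in\mathbb N$, $t\in[t_1,t_2]$. $y\in G^{s_1,s_2}([x_1,x_2]\times[t_1,t_2])$ if $y\in C^\infty$ and $|\partial_x^{p_1}\partial_t^{p_2}y(x,t)|\le C(p_1!)^{s_1}(p_2!)^{s_2}/(R_1^{p_1}R_2^{p_2})$ for some $C,R_1,R_2>0$, all $(x,t)$ and all $p_1,p_2\in\mathbb N$.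 *)

(* Defs.v *)
From Stdlib Require Import Reals Factorial Lra.
From Coquelicot Require Import Coquelicot.
Open Scope R_scope.

(* Functions on a compact interval or rectangle are represented by total
   functions on R or R -> R -> R, of which only the values on that set matter.
   Derivatives are therefore taken relative to [a, b], hence one-sided at the
   endpoints: this is Coquelicot's [is_derive] with [locally x] restricted to
   the interval. *)
Definition is_derive_on (a b : R) (f : R -> R) (x l : R) : Prop :=
  filterdiff f (within (fun u => a <= u <= b) (locally x)) (fun u => scal u l).

Definition ex_derive_on (a b : R) (f : R -> R) (x : R) : Prop :=
  exists l : R, is_derive_on a b f x l.

(* Junk value where the derivative does not exist. *)
Definition Derive_on (a b : R) (f : R -> R) (x : R) : R :=
  iota (is_derive_on a b f x).

Fixpoint Derive_n_on (a b : R) (n : nat) (f : R -> R) : R -> R :=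
  match n with
  | O => f
  | S k => Derive_on a b (Derive_n_on a b k f)
  end.

(* [D1_on x1 x2] and [D2_on t1 t2] are the partial derivatives with respect to
   the first and the second variable. *)
Definition D1_on (x1 x2 : R) (y : R -> R -> R) : R -> R -> R :=
  fun x t => Derive_on x1 x2 (fun u => y u t) x.

Definition D2_on (t1 t2 : R) (y : R -> R -> R) : R -> R -> R :=
  fun x t => Derive_on t1 t2 (fun u => y x u) t.

Definition D1_n_on (x1 x2 : R) (n : nat) (y : R -> R -> R) : R -> R -> R :=
  Nat.iter n (D1_on x1 x2) y.

Definition D2_n_on (t1 t2 : R) (n : nat) (y : R -> R -> R) : R -> R -> R :=
  Nat.iter n (D2_on t1 t2) y.

Definition smooth_on (a b : R) (h : R -> R) : Prop :=
  forall (n : nat) (t : R), a <= t <= b -> ex_derive_on a b (Derive_n_on a b n h) t.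

Definition rect (x1 x2 t1 t2 : R) (p : R * R) : Prop :=
  x1 <= fst p <= x2 /\ t1 <= snd p <= t2.

Fixpoint C_n_rect (x1 x2 t1 t2 : R) (n : nat) (y : R -> R -> R) : Prop :=
  continuous_on (rect x1 x2 t1 t2) (fun p => y (fst p) (snd p)) /\
  match n with
  | O => True
  | S k =>
      (forall x t, x1 <= x <= x2 -> t1 <= t <= t2 ->
         ex_derive_on x1 x2 (fun u => y u t) x /\
         ex_derive_on t1 t2 (fun u => y x u) t) /\
      C_n_rect x1 x2 t1 t2 k (D1_on x1 x2 y) /\
      C_n_rect x1 x2 t1 t2 k (D2_on t1 t2 y)
  end.

Definition smooth_rect (x1 x2 t1 t2 : R) (y : R -> R -> R) : Prop :=
  forall n : nat, C_n_rect x1 x2 t1 t2 n y.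

(* The order s is a real number, hence [Rpower]. *)
Definition Gevrey (s t1 t2 : R) (h : R -> R) : Prop :=
  smooth_on t1 t2 h /\
  exists M r : R, 0 < M /\ 0 < r /\
    forall (p : nat) (t : R), t1 <= t <= t2 ->
      Rabs (Derive_n_on t1 t2 p h t) <= M * Rpower (INR (fact p)) s / r ^ p.

Definition Gevrey2 (s1 s2 x1 x2 t1 t2 : R) (y : R -> R -> R) : Prop :=
  smooth_rect x1 x2 t1 t2 y /\
  exists M r1 r2 : R, 0 < M /\ 0 < r1 /\ 0 < r2 /\
    forall (p1 p2 : nat) (x t : R), x1 <= x <= x2 -> t1 <= t <= t2 ->
      Rabs (D1_n_on x1 x2 p1 (D2_n_on t1 t2 p2 y) x t) <=
      M * Rpower (INR (fact p1)) s1 * Rpower (INR (fact p2)) s2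
        / (r1 ^ p1 * r2 ^ p2).

(* The class written R_{r,c} in the literature. *)
Definition in_class_R (r c : R) (z : R -> R) : Prop :=
  exists alpha : nat -> R,
    (forall n : nat, Rabs (alpha n) <= c * INR (fact n) / r ^ n) /\
    forall x : R, -1 <= x <= 1 ->
      is_pseries (fun n => alpha n / INR (fact n)) x (z x).

Definition odd_on_sym (z : R -> R) : Prop :=
  forall x : R, -1 <= x <= 1 -> z (- x) = - z x.

Definition R_hat : R := 16 * exp (/ (4 * exp 1)).

Lemma is_derive_on_derive (a b : R) (f : R -> R) (x l : R) :
  a <= x <= b -> is_derive f x l -> is_derive_on a b f x l.
Proof.
intros Hx [Hl Hd]; split; [exact Hl|].
intros x' Hx'.
assert (E : x = x').
{ destruct (Req_dec x x') as [e|ne]; [exact e|exfalso].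
  assert (He : 0 < Rabs (x - x')) by (apply Rabs_pos_lt; lra).
  assert (H := Hx' _ (locally_ball x' (mkposreal _ He))).
  destruct H as [d Hd'].
  assert (H := Hd' x (ball_center x d) Hx).
  unfold ball in H; simpl in H; unfold AbsRing_ball, abs, minus, plus, opp in H.
  simpl in H. unfold Rminus in H. lra. }
subst x'.
intros e.
assert (Hx0 : is_filter_lim (locally x) x) by (intros P HP; exact HP).
generalize (Hd x Hx0 e); unfold within.
apply filter_imp; intros u Hu _; exact Hu.
Qed.

Lemma is_derive_on_unique (a b : R) (f : R -> R) (x l : R) :
  a < b -> a <= x <= b -> is_derive_on a b f x l -> Derive_on a b f x = l.
Proof.
intros Hab Hx Hl.
assert (Hlim : is_filter_lim (within (fun u => a <= u <= b) (locally x)) x).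
{ intros P HP; unfold within; revert HP.
  apply filter_imp; intros u Hu _; exact Hu. }
unfold Derive_on; apply (@iota_unique _ R_CompleteNormedModule); [|exact Hl].
intros m Hm.
apply Rminus_diag_uniq.
destruct (Req_dec (m - l) 0) as [e|ne]; [exact e|exfalso].
assert (He : 0 < Rabs (m - l) / 4) by (assert (h := Rabs_pos_lt _ ne); lra).
assert (H1 := proj2 Hl x Hlim (mkposreal _ He)).
assert (H2 := proj2 Hm x Hlim (mkposreal _ He)).
destruct (filter_and _ _ H1 H2) as [d Hd]; simpl in Hd.
assert (Hu : exists u, a <= u <= b /\ 0 < Rabs (u - x) < d).
{ destruct d as [d d0]; simpl in *.
  destruct (Rlt_dec x b) as [xb|xb].
  - exists (x + Rmin ((b - x) / 2) (d / 2)).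
    assert (h1 := Rmin_l ((b - x) / 2) (d / 2)).
    assert (h2 := Rmin_r ((b - x) / 2) (d / 2)).
    assert (h3 : 0 < Rmin ((b - x) / 2) (d / 2)) by (apply Rmin_glb_lt; lra).
    split; [lra|].
    rewrite Rabs_pos_eq; lra.
  - exists (x - Rmin ((x - a) / 2) (d / 2)).
    assert (h1 := Rmin_l ((x - a) / 2) (d / 2)).
    assert (h2 := Rmin_r ((x - a) / 2) (d / 2)).
    assert (h3 : 0 < Rmin ((x - a) / 2) (d / 2)) by (apply Rmin_glb_lt; lra).
    split; [lra|].
    rewrite Rabs_left; lra. }
destruct Hu as [u [Hu1 [Hu2 Hu3]]].
destruct (Hd u Hu3 Hu1) as [Ha Hb].
unfold norm, minus, plus, opp, scal in Ha, Hb; simpl in Ha, Hb.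
unfold abs, mult in Ha, Hb; simpl in Ha, Hb.
change (u + - x) with (u - x) in Ha, Hb.
assert (T : Rabs ((u - x) * (m - l)) <= 2 * (Rabs (m - l) / 4 * Rabs (u - x))).
{ replace ((u - x) * (m - l)) with
    ((f u + - f x + - ((u - x) * l)) - (f u + - f x + - ((u - x) * m))) by ring.
  eapply Rle_trans; [apply Rabs_triang|].
  rewrite Rabs_Ropp; lra. }
rewrite Rabs_mult in T.
assert (0 < Rabs (u - x) * Rabs (m - l)) by (apply Rmult_lt_0_compat; lra).
lra.
Qed.

(* Main.v *)
Require Import Defs.
From Stdlib Require Import Reals Lra Lia Psatz Arith.
From Coquelicot Require Import Coquelicot.
Open Scope R_scope.

(** The solution is sought as a power series y(x,t) = sum_k b_k(t) x^k.  Read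
    as an evolution in x, the equation says

      (k+1)(k+2)(k+3)(k+4) b_{k+4}
         = - b_k' - (k+1)(k+2) b_{k+2} - sum_{j<=k} (k+1-j) b_j b_{k+1-j},

    so that b_0 = b_2 = 0 (the boundary conditions at x = 0) and the two free
    functions b_1, b_3 of t determine everything; v and w are read off at x = 1.
    The same relation, read as a formula for b_k', turns the coefficients of y^0
    into the complete jets of b_1 and b_3 at t = 0, and those of the target into
    the jets at t = T.  It is therefore enough to find b_1, b_3 on [0,T] that have
    these jets at both ends: the recursion then reproduces all coefficients of
    both states ([ks_array_unique], [lateral_state]).

    Convergence.  One derivative in t costs four derivatives in x, so the natural
    size of the n-th derivative of b_k is (k+4n)! / (k! A^k B^n), see [weight].
    These weights propagate through the recursion in either direction
    ([ks_bound_x], [ks_bound_t]): d_t against d_x^4 is a matter of comparing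
    A^4 with B, and the remaining terms have lower order, so they gain factors
    k+4n; the quadratic term is small besides, since the data are.  Starting from
    radius A = 16 at the initial and final times (r > R_hat >= 16) this gives jets
    of size (4n+3)! / 2048^n for b_1 and b_3.  Conversely b_1, b_3 with derivatives
    of size (4n)! / 6^n, up to a small constant, give a power series of radius
    4/3 > 1, all of whose derivatives satisfy Gevrey (1,4) bounds.

    Interpolating the jets ([borel_two_point]).  Since t^n / n! is the integral of
    (t s^3)^n e^{-s} / (n! (3n)!) over s > 0, replace it by the integral over
    0 < s < (a/t)^(1/3).  This changes the function by something flat at t = 0, so
    the jet at 0 is kept, but now the argument t s^3 stays below a; the p-th
    derivative is bounded by 2 (4p)! (2a)^n / (a^p n! (3n)!) ([cut_monomial_le]),
    and the sum over n against the prescribed jet converges.  Multiplying by a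
    cut-off of the same Gevrey class makes the function flat at t = T; the jet at
    T is treated by reflection.  The gap between the radii 16 and 4/3 in x pays for
    the loss of time radius from 2048 to 6, and the smallness of the states absorbs
    the constants that depend on T. *)

(** * Factorials and Leibniz products *)

Lemma INR_fact_S (n : nat) : INR (fact (S n)) = (INR n + 1) * INR (fact n).
Proof. rewrite fact_simpl, mult_INR, S_INR; ring. Qed.

Lemma INR_fact_pos (n : nat) : 0 < INR (fact n).
Proof. apply INR_fact_lt_0. Qed.

(** One term of the binomial expansion of (x + y)^(k+q) = 1, proved through
    Pascal's rule. *)
Lemma fact_prod_weighted (x y : R) (k q : nat) :
  0 < x -> 0 < y -> x + y = 1 ->
  INR (fact (k + q)) * x ^ k * y ^ q <= INR (fact k) * INR (fact q).
Proof.
intros hx hy hxy.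
assert (x1 : x <= 1) by lra.
assert (y1 : y <= 1) by lra.
assert (pw : forall u n, 0 < u -> u <= 1 -> 0 < u ^ n <= 1).
{ intros u n hu hu1; split; [apply pow_lt; lra|].
  rewrite <- (pow1 n); apply pow_incr; lra. }
remember (k + q)%nat as s eqn:es.
revert k q es; induction s as [|s IH]; intros k q es.
- assert (k = 0%nat) by lia; assert (q = 0%nat) by lia; subst; simpl; lra.
- destruct k as [|k].
  { simpl in es; subst q. assert (h := pw y (S s) hy y1).
    assert (hp := INR_fact_pos (S s)).
    simpl (x ^ 0). change (INR (fact 0)) with 1. nra. }
  destruct q as [|q].
  { replace (S s) with (S k) by lia. assert (h := pw x (S k) hx x1).
    assert (hp := INR_fact_pos (S k)).
    simpl (y ^ 0). change (INR (fact 0)) with 1. nra. }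
  assert (h1 := IH k (S q) ltac:(lia)).
  assert (h2 := IH (S k) q ltac:(lia)).
  assert (e : INR s + 1 = (INR k + 1) + (INR q + 1)).
  { replace s with (k + S q)%nat by lia. rewrite plus_INR, S_INR; ring. }
  rewrite INR_fact_S, e.
  replace ((INR k + 1 + (INR q + 1)) * INR (fact s) * x ^ S k * y ^ S q) with
    (x * (INR k + 1) * (INR (fact s) * x ^ k * y ^ S q)
     + y * (INR q + 1) * (INR (fact s) * x ^ S k * y ^ q)) by (simpl; ring).
  assert (hk := pos_INR k). assert (hq := pos_INR q).
  assert (g1 : x * (INR k + 1) * (INR (fact s) * x ^ k * y ^ S q)
     <= x * (INR k + 1) * (INR (fact k) * INR (fact (S q)))).
  { apply Rmult_le_compat_l; [nra|exact h1]. }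
  assert (g2 : y * (INR q + 1) * (INR (fact s) * x ^ S k * y ^ q)
     <= y * (INR q + 1) * (INR (fact (S k)) * INR (fact q))).
  { apply Rmult_le_compat_l; [nra|exact h2]. }
  rewrite !INR_fact_S in *.
  replace ((INR k + 1) * INR (fact k) * ((INR q + 1) * INR (fact q))) with
    (x * (INR k + 1) * (INR (fact k) * ((INR q + 1) * INR (fact q)))
     + y * (INR q + 1) * ((INR k + 1) * INR (fact k) * INR (fact q)))
    by (replace y with (1 - x) by lra; ring).
  lra.
Qed.

Lemma fact_add_le (a b : nat) :
  INR (fact (a + b)) <= 2 ^ (a + b) * (INR (fact a) * INR (fact b)).
Proof.
assert (h := fact_prod_weighted (1/2) (1/2) a b ltac:(lra) ltac:(lra) ltac:(lra)).
rewrite Rmult_assoc, <- pow_add in h.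
replace (INR (fact (a + b))) with
  (2 ^ (a + b) * (INR (fact (a + b)) * (1 / 2) ^ (a + b))).
- apply Rmult_le_compat_l; [apply pow_le; lra|exact h].
- rewrite (Rmult_comm (INR _)), <- Rmult_assoc, <- Rpow_mult_distr.
  replace (2 * (1 / 2)) with 1 by field. rewrite pow1; ring.
Qed.

Lemma fact_mul_le (a b : nat) :
  INR (fact a) * INR (fact b) <= INR (fact (a + b)).
Proof.
induction a as [|a IH]; [simpl; lra|].
change (S a + b)%nat with (S (a + b)).
rewrite !INR_fact_S, plus_INR, Rmult_assoc.
assert (h1 := pos_INR a); assert (h2 := pos_INR b).
assert (h3 := INR_fact_pos a); assert (h4 := INR_fact_pos b).
assert (h5 := INR_fact_pos (a + b)). nra.
Qed.

(** The n-th derivative of a product, from the derivatives of its factors.  The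
    recursion applies the product rule to the first derivative taken, so no binomial
    coefficient appears and derivatives and estimates go by plain induction. *)
Fixpoint leibniz (F G : nat -> R) (n : nat) : R :=
  match n with
  | O => F 0%nat * G 0%nat
  | S n => leibniz (fun i => F (S i)) G n + leibniz F (fun i => G (S i)) n
  end.

Lemma leibniz_ext (n : nat) : forall F F' G G' : nat -> R,
  (forall i, (i <= n)%nat -> F i = F' i) -> (forall i, (i <= n)%nat -> G i = G' i) ->
  leibniz F G n = leibniz F' G' n.
Proof.
induction n as [|n IH]; intros F F' G G' hF hG; simpl.
- rewrite hF, hG by lia; reflexivity.
- f_equal; apply IH; intros; (apply hF || apply hG); lia.
Qed.

Lemma leibniz_0_l (n : nat) : forall F G : nat -> R,
  (forall i, (i <= n)%nat -> F i = 0) -> leibniz F G n = 0.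
Proof.
induction n as [|n IH]; intros F G hF; simpl.
- rewrite hF by lia; ring.
- rewrite !IH; [ring|..]; intros; apply hF; lia.
Qed.

Lemma leibniz_0_r (n : nat) : forall F G : nat -> R,
  (forall i, (i <= n)%nat -> G i = 0) -> leibniz F G n = 0.
Proof.
induction n as [|n IH]; intros F G hG; simpl.
- rewrite hG by lia; ring.
- rewrite !IH; [ring|..]; intros; apply hG; lia.
Qed.

Lemma leibniz_1_l (n : nat) : forall F G : nat -> R,
  F 0%nat = 1 -> (forall i, F (S i) = 0) -> leibniz F G n = G n.
Proof.
induction n as [|n IH]; intros F G h0 h1; simpl.
- rewrite h0; ring.
- rewrite leibniz_0_l by (intros; apply h1).
  rewrite IH by assumption; ring.
Qed.

(** The factor by which (k+4)! exceeds k!: the cost of one time derivative. *)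
Definition rise4 (k : nat) : R :=
  (INR k + 1) * (INR k + 2) * (INR k + 3) * (INR k + 4).

Lemma rise4_pos (k : nat) : 0 < rise4 k.
Proof.
unfold rise4. assert (h := pos_INR k).
repeat apply Rmult_lt_0_compat; lra.
Qed.

Lemma fact_plus4 (k : nat) : INR (fact (k + 4)) = rise4 k * INR (fact k).
Proof.
replace (k + 4)%nat with (S (S (S (S k)))) by lia.
rewrite !INR_fact_S, !S_INR; unfold rise4; ring.
Qed.

(** The bound (k+m+4n)! k! m! / (k+m)! is stable under the Leibniz recursion as
    soon as [rise4] is superadditive up to the radii.  This holds with a common
    radius if k, m >= 1 ([rise4_superadd]) and, for all k and m, if the inverses of
    the radii add up ([rise4_radii]). *)
Lemma leibniz_bound (k0 : nat) (r1 r2 r3 : R) :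
  0 < r1 -> 0 < r2 -> 0 < r3 ->
  (forall k m, (k0 <= k)%nat -> (k0 <= m)%nat ->
     rise4 k / r1 + rise4 m / r2 <= rise4 (k + m) / r3) ->
  forall (n k m : nat) (cF cG : R) (F G : nat -> R),
  (k0 <= k)%nat -> (k0 <= m)%nat -> 0 <= cF -> 0 <= cG ->
  (forall i, (i <= n)%nat -> Rabs (F i) <= cF * INR (fact (k + 4 * i)) / r1 ^ i) ->
  (forall i, (i <= n)%nat -> Rabs (G i) <= cG * INR (fact (m + 4 * i)) / r2 ^ i) ->
  Rabs (leibniz F G n) <=
    cF * cG * (INR (fact k) * INR (fact m) / INR (fact (k + m)))
    * INR (fact (k + m + 4 * n)) / r3 ^ n.
Proof.
intros h1 h2 h3 hr n.
induction n as [|n IH]; intros k m cF cG F G hk hm hF0 hG0 hF hG.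
- simpl leibniz. rewrite Rabs_mult.
  assert (eF := hF 0%nat (le_n _)). assert (eG := hG 0%nat (le_n _)).
  rewrite Nat.mul_0_r, Nat.add_0_r in *. simpl pow in *.
  assert (p := INR_fact_pos (k + m)).
  replace (cF * cG * (INR (fact k) * INR (fact m) / INR (fact (k + m))) *
    INR (fact (k + m)) / 1) with ((cF * INR (fact k) / 1) * (cG * INR (fact m) / 1))
    by (field; lra).
  apply Rmult_le_compat; auto using Rabs_pos.
- simpl leibniz. eapply Rle_trans; [apply Rabs_triang|].
  assert (eF := IH (k + 4)%nat m (cF / r1) cG (fun i => F (S i)) G ltac:(lia) hm).
  assert (eG := IH k (m + 4)%nat cF (cG / r2) F (fun i => G (S i)) hk ltac:(lia)).
  assert (r1n : forall j, 0 < r1 ^ j) by (intros; apply pow_lt; lra).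
  assert (r2n : forall j, 0 < r2 ^ j) by (intros; apply pow_lt; lra).
  assert (r3n : forall j, 0 < r3 ^ j) by (intros; apply pow_lt; lra).
  assert (EF : Rabs (leibniz (fun i => F (S i)) G n) <=
    cF / r1 * cG * (INR (fact (k + 4)) * INR (fact m) / INR (fact (k + 4 + m)))
    * INR (fact (k + 4 + m + 4 * n)) / r3 ^ n).
  { apply eF; auto.
    - apply Rmult_le_pos; [lra|left; apply Rinv_0_lt_compat; lra].
    - intros i hi. eapply Rle_trans; [apply hF; lia|].
      replace (k + 4 * S i)%nat with (k + 4 + 4 * i)%nat by lia.
      right. simpl pow. field; split; [lra|apply Rgt_not_eq, r1n]. }
  assert (EG : Rabs (leibniz F (fun i => G (S i)) n) <=
    cF * (cG / r2) * (INR (fact k) * INR (fact (m + 4)) / INR (fact (k + (m + 4))))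
    * INR (fact (k + (m + 4) + 4 * n)) / r3 ^ n).
  { apply eG; auto.
    - apply Rmult_le_pos; [lra|left; apply Rinv_0_lt_compat; lra].
    - intros i hi. eapply Rle_trans; [apply hG; lia|].
      replace (m + 4 * S i)%nat with (m + 4 + 4 * i)%nat by lia.
      right. simpl pow. field; split; [lra|apply Rgt_not_eq, r2n]. }
  clear eF eG IH hF hG.
  replace (k + 4 + m)%nat with (k + m + 4)%nat in EF by lia.
  replace (k + (m + 4))%nat with (k + m + 4)%nat in EG by lia.
  replace (k + m + 4 * S n)%nat with (k + m + 4 + 4 * n)%nat by lia.
  set (N := INR (fact (k + m + 4 + 4 * n))) in *.
  assert (hN : 0 < N) by apply INR_fact_pos.
  rewrite (fact_plus4 (k + m)), (fact_plus4 k) in EF.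
  rewrite (fact_plus4 (k + m)), (fact_plus4 m) in EG.
  assert (hkm := hr k m hk hm).
  assert (pk := rise4_pos k). assert (pm := rise4_pos m).
  assert (pkm := rise4_pos (k + m)).
  assert (fk := INR_fact_pos k). assert (fm := INR_fact_pos m).
  assert (fkm := INR_fact_pos (k + m)).
  set (V := cF * cG * (INR (fact k) * INR (fact m) / INR (fact (k + m))) * N / r3 ^ n).
  assert (hV : 0 <= V).
  { unfold V. apply Rmult_le_pos; [|left; apply Rinv_0_lt_compat, r3n].
    apply Rmult_le_pos; [|lra]. apply Rmult_le_pos; [nra|].
    apply Rmult_le_pos; [nra|left; apply Rinv_0_lt_compat; lra]. }
  apply Rle_trans with (V * (rise4 k / r1 + rise4 m / r2) / rise4 (k + m)).
  { eapply Rle_trans; [apply Rplus_le_compat; [exact EF|exact EG]|].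
    right. unfold V. assert (q := r3n n). field. repeat split; lra. }
  apply Rle_trans with (V * (rise4 (k + m) / r3) / rise4 (k + m)).
  { apply Rmult_le_compat_r; [left; apply Rinv_0_lt_compat; lra|].
    apply Rmult_le_compat_l; [exact hV|exact hkm]. }
  right. unfold V. simpl pow. assert (q := r3n n). field. repeat split; lra.
Qed.

Lemma Rle_exists_shift (x : R) : 1 <= x -> exists u, 0 <= u /\ x = u + 1.
Proof. exists (x - 1); split; lra. Qed.

(** After the shift k = u + 1, m = v + 1 the difference is a polynomial with
    nonnegative coefficients; for k = m = 0 the inequality fails. *)
Lemma rise4_superadd (r : R) (k m : nat) : 0 < r -> (1 <= k)%nat -> (1 <= m)%nat ->
  rise4 k / r + rise4 m / r <= rise4 (k + m) / r.
Proof.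
intros hr hk hm.
assert (0 < / r) by (apply Rinv_0_lt_compat; lra).
unfold Rdiv. rewrite <- Rmult_plus_distr_r. apply Rmult_le_compat_r; [lra|].
unfold rise4. rewrite plus_INR.
apply le_INR in hk. apply le_INR in hm. simpl in hk, hm.
destruct (Rle_exists_shift _ hk) as [u [hu ->]].
destruct (Rle_exists_shift _ hm) as [v [hv ->]].
apply Rminus_le_0.
match goal with |- 0 <= ?e => replace e with
  (4 * u^3 * v + 4 * u^3 + 6 * u^2 * v^2 + 54 * u^2 * v + 48 * u^2 + 4 * u * v^3
   + 54 * u * v^2 + 238 * u * v + 188 * u + 4 * v^3 + 48 * v^2 + 188 * v + 120) by ring end.
repeat (apply Rplus_le_le_0_compat || apply Rmult_le_pos || apply pow_le); lra.
Qed.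

Lemma rise4_mono (k m : nat) : (k <= m)%nat -> rise4 k <= rise4 m.
Proof.
intros h. apply le_INR in h. assert (p := pos_INR k). unfold rise4.
repeat apply Rmult_le_compat; try lra; repeat apply Rmult_le_pos; lra.
Qed.

Lemma rise4_radii (r1 r2 r3 : R) (k m : nat) : 0 < r1 -> 0 < r2 ->
  / r1 + / r2 <= / r3 -> rise4 k / r1 + rise4 m / r2 <= rise4 (k + m) / r3.
Proof.
intros h1 h2 h.
assert (a1 := rise4_mono k (k + m) ltac:(lia)).
assert (a2 := rise4_mono m (k + m) ltac:(lia)).
apply Rinv_0_lt_compat in h1. apply Rinv_0_lt_compat in h2.
assert (p := rise4_pos (k + m)). unfold Rdiv.
apply Rle_trans with (rise4 (k + m) * (/ r1 + / r2)).
- rewrite Rmult_plus_distr_l.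
  apply Rplus_le_compat; apply Rmult_le_compat_r; lra.
- apply Rmult_le_compat_l; lra.
Qed.

(** * The recursion for the Taylor coefficients *)

(** The x^k-coefficient of the n-th time derivative of y_xx + y y_x, where
    [e k n] is the n-th time derivative of the coefficient of x^k in y. *)
Definition ks_lower (e : nat -> nat -> R) (k n : nat) : R :=
  (INR k + 1) * (INR k + 2) * e (k + 2)%nat n +
  sum_f_R0 (fun j => INR (S (k - j)) * leibniz (e j) (e (S (k - j))) n) k.

(** The equation y_t = - y_xxxx - y_xx - y y_x at one time, coefficient by
    coefficient and for all its time derivatives. *)
Definition ks_array (e : nat -> nat -> R) : Prop :=
  forall k n, e k (S n) = - (rise4 k * e (k + 4)%nat n + ks_lower e k n).

(** The relation gives the row k + 4 in terms of the rows 0, ..., k + 2. *)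
Lemma ks_array_unique (e e' : nat -> nat -> R) :
  ks_array e -> ks_array e' ->
  (forall k n, (k < 4)%nat -> e k n = e' k n) -> forall k n, e k n = e' k n.
Proof.
intros he he' h k.
induction k as [k IH] using lt_wf_ind; intros n.
destruct (le_lt_dec 4 k) as [hk|hk]; [|apply h; lia].
replace k with (k - 4 + 4)%nat by lia. set (m := (k - 4)%nat).
assert (p := rise4_pos m).
assert (El : ks_lower e m n = ks_lower e' m n).
{ unfold ks_lower. f_equal; [rewrite IH by lia; reflexivity|].
  apply sum_eq; intros j hj. f_equal.
  apply leibniz_ext; intros i _; apply IH; lia. }
assert (E1 := he m n). assert (E2 := he' m n).
rewrite IH in E1 by lia. rewrite El in E1. rewrite E2 in E1.
apply Rmult_eq_reg_l with (rise4 m); lra.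
Qed.

(** If y is odd in x, so is y_xx + y y_x: in each product of the quadratic term one
    of the indices j and k+1-j is even when k is. *)
Lemma ks_lower_even (e : nat -> nat -> R) (k n : nat) : Nat.Even k ->
  (forall j i, (i <= n)%nat -> Nat.Even j -> e j i = 0) -> ks_lower e k n = 0.
Proof.
intros hk h. unfold ks_lower.
rewrite h by (auto; destruct hk as [l ->]; exists (l + 1)%nat; lia).
rewrite (sum_eq _ (fun _ => 0)).
- rewrite sum_cte; ring.
- intros j hj. destruct (Nat.Even_or_Odd j) as [hje|hjo].
  + rewrite leibniz_0_l; [ring|intros; apply h; assumption].
  + rewrite leibniz_0_r; [ring|intros; apply h; [assumption|]].
    destruct hk as [l ->]. destruct hjo as [q ->]. exists (l - q)%nat; lia.
Qed.

Definition weight (A B M : R) (k n : nat) : R :=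
  M * INR (fact (k + 4 * n)) / (INR (fact k) * A ^ k * B ^ n).

(** The common factor of all the terms that are compared in [ks_bound_x] and
    [ks_bound_t]: what [weight] becomes three derivatives below the top order. *)
Definition weight_unit (A B M : R) (k n : nat) : R :=
  M * INR (fact (k + 1 + 4 * n)) / (INR (fact k) * A ^ (k + 1) * B ^ n).

Lemma weight_unit_ge0 (A B M : R) (k n : nat) : 0 < A -> 0 < B -> 0 <= M ->
  0 <= weight_unit A B M k n.
Proof.
intros hA hB hM. unfold weight_unit.
apply Rmult_le_pos.
- apply Rmult_le_pos; [lra|left; apply INR_fact_pos].
- left; apply Rinv_0_lt_compat. assert (h := INR_fact_pos k).
  repeat apply Rmult_lt_0_compat; try apply pow_lt; lra.
Qed.

(** Compared with [weight_unit], y_xx keeps one of the three missing factors, and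
    y y_x keeps one too, from the number of terms of the convolution.  The terms with
    j = 0 must vanish since [rise4_superadd] needs positive indices. *)
Lemma ks_lower_bound (A B M : R) (e : nat -> nat -> R) (k n : nat) :
  0 < A -> 0 < B -> 0 <= M ->
  (forall i, (i <= n)%nat -> e 0%nat i = 0) ->
  (forall j i, (j <= k + 2)%nat -> (i <= n)%nat -> Rabs (e j i) <= weight A B M j i) ->
  Rabs (ks_lower e k n) <= weight_unit A B M k n *
    ((INR k + 2 + 4 * INR n) / A + M * (INR k + 1)).
Proof.
intros hA hB hM h0 h.
assert (pA : forall j, 0 < A ^ j) by (intros; apply pow_lt; lra).
assert (pB : forall j, 0 < B ^ j) by (intros; apply pow_lt; lra).
assert (pf := INR_fact_pos). assert (pk := pos_INR k).
unfold ks_lower. eapply Rle_trans; [apply Rabs_triang|].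
rewrite (Rmult_plus_distr_l (weight_unit A B M k n)). apply Rplus_le_compat.
- rewrite Rabs_mult, (Rabs_pos_eq ((INR k + 1) * (INR k + 2)))
    by (apply Rmult_le_pos; lra).
  eapply Rle_trans.
  { apply Rmult_le_compat_l; [apply Rmult_le_pos; lra|apply h; lia]. }
  right. unfold weight, weight_unit.
  replace (k + 2 + 4 * n)%nat with (S (k + 1 + 4 * n)) by lia.
  replace (k + 2)%nat with (S (S k)) by lia. replace (k + 1)%nat with (S k) by lia.
  rewrite (INR_fact_S (S k)), (INR_fact_S k), (INR_fact_S (S k + 4 * n)).
  rewrite plus_INR, mult_INR, !S_INR. simpl (INR 4). simpl pow.
  assert (q1 := pA k). assert (q2 := pB n). assert (q3 := pf k).
  simpl (INR 0). field. repeat split; lra.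
- eapply Rle_trans; [apply Rsum_abs|].
  apply Rle_trans with (sum_f_R0 (fun _ => (INR k + 1) *
     (M * M * INR (fact (k + 1 + 4 * n)) / (INR (fact (k + 1)) * A ^ (k + 1) * B ^ n))) k).
  2:{ rewrite sum_cte. right. unfold weight_unit.
      replace (k + 1)%nat with (S k) by lia. rewrite (INR_fact_S k), S_INR.
      assert (q1 := pA (S k)). assert (q2 := pB n). assert (q3 := pf k).
      field. repeat split; lra. }
  assert (hV : forall V, 0 <= V -> 0 <= V / (INR (fact (k + 1)) * A ^ (k + 1) * B ^ n)).
  { intros V hV. apply Rmult_le_pos; [exact hV|left; apply Rinv_0_lt_compat].
    repeat apply Rmult_lt_0_compat; auto. }
  apply sum_Rle; intros j hj.
  rewrite Rabs_mult, Rabs_pos_eq by apply pos_INR.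
  apply Rmult_le_compat; [apply pos_INR|apply Rabs_pos| |].
  + rewrite S_INR. apply Rplus_le_compat_r, le_INR; lia.
  + destruct j as [|j].
    { rewrite leibniz_0_l by exact h0. rewrite Rabs_R0. apply hV.
      repeat apply Rmult_le_pos; auto. left; apply pf. }
    set (m := S (k - S j)).
    assert (hw : forall i l, (i <= k + 2)%nat -> (l <= n)%nat ->
      Rabs (e i l) <= M / (INR (fact i) * A ^ i) * INR (fact (i + 4 * l)) / B ^ l).
    { intros i l hi hl. eapply Rle_trans; [apply h; assumption|].
      right; unfold weight. assert (q1 := pA i). assert (q2 := pB l). assert (q3 := pf i).
      field. repeat split; lra. }
    assert (hc : forall i, 0 <= M / (INR (fact i) * A ^ i)).
    { intros i. apply Rmult_le_pos; [exact hM|left; apply Rinv_0_lt_compat].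
      apply Rmult_lt_0_compat; auto. }
    eapply Rle_trans.
    { apply (leibniz_bound 1 B B B hB hB hB) with (k := S j) (m := m)
        (cF := M / (INR (fact (S j)) * A ^ S j)) (cG := M / (INR (fact m) * A ^ m)).
      - intros; apply rise4_superadd; assumption.
      - lia.
      - unfold m; lia.
      - apply hc.
      - apply hc.
      - intros i hi. apply hw; lia.
      - intros i hi. apply hw; unfold m; lia. }
    right. replace (k + 1)%nat with (S j + m)%nat by (unfold m; lia).
    rewrite pow_add.
    assert (q1 := pA (S j)). assert (q2 := pA m). assert (q3 := pB n).
    assert (q4 := pf (S j)). assert (q5 := pf m). assert (q6 := pf (S j + m)%nat).
    field. repeat split; lra.
Qed.

Definition cubic (k n : nat) : R :=
  (INR k + 2 + 4 * INR n) * (INR k + 3 + 4 * INR n) * (INR k + 4 + 4 * INR n).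

Lemma cubic_ge (k n : nat) : 12 * (INR k + 2 + 4 * INR n) <= cubic k n.
Proof.
assert (h := pos_INR k). assert (h' := pos_INR n). unfold cubic.
assert (g : 0 <= INR k + 4 * INR n) by lra.
assert (12 <= (INR k + 3 + 4 * INR n) * (INR k + 4 + 4 * INR n)) by nra.
rewrite Rmult_assoc, (Rmult_comm 12). apply Rmult_le_compat_l; lra.
Qed.

Lemma fact_cubic (k n : nat) :
  INR (fact (k + 4 + 4 * n)) = cubic k n * INR (fact (k + 1 + 4 * n)).
Proof.
replace (k + 4 + 4 * n)%nat with (S (S (S (k + 1 + 4 * n)))) by lia.
rewrite !INR_fact_S, !S_INR, !plus_INR, mult_INR. simpl (INR 4). simpl (INR 1).
unfold cubic. ring.
Qed.

Lemma weight_shift_x (A B M : R) (k n : nat) : 0 < A -> 0 < B ->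
  rise4 k * weight A B M (k + 4) n = weight_unit A B M k n * (cubic k n / A ^ 3).
Proof.
intros hA hB. unfold weight, weight_unit.
rewrite fact_cubic, fact_plus4, !pow_add.
assert (q1 := pow_lt A k hA). assert (q2 := pow_lt B n hB).
assert (q3 := INR_fact_pos k). assert (q4 := rise4_pos k).
field. repeat split; lra.
Qed.

Lemma weight_shift_t (A B M : R) (k n : nat) : 0 < A -> 0 < B ->
  weight A B M k (S n) = weight_unit A B M k n * (cubic k n * A / B).
Proof.
intros hA hB. unfold weight, weight_unit.
replace (k + 4 * S n)%nat with (k + 4 + 4 * n)%nat by lia.
rewrite fact_cubic, !pow_add. simpl (B ^ S n).
assert (q1 := pow_lt A k hA). assert (q2 := pow_lt B n hB).
assert (q3 := INR_fact_pos k).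
field. repeat split; lra.
Qed.

(** Solving in x.  The three terms of the condition are those of y_t, y_xx and y y_x;
    the last two have been weakened by [cubic_ge]. *)
Lemma ks_bound_x (A B M : R) (e : nat -> nat -> R) :
  0 < A -> 0 < B -> 0 <= M -> A / B + / (12 * A) + M / 12 <= / A ^ 3 ->
  ks_array e -> (forall n, e 0%nat n = 0) ->
  (forall k n, (k < 4)%nat -> Rabs (e k n) <= weight A B M k n) ->
  forall k n, Rabs (e k n) <= weight A B M k n.
Proof.
intros hA hB hM hAB he h0 h k.
induction k as [k IH] using lt_wf_ind; intros n.
destruct (le_lt_dec 4 k) as [hk|hk]; [|apply h; lia].
replace k with (k - 4 + 4)%nat by lia. set (m := (k - 4)%nat).
assert (p := rise4_pos m).
apply Rmult_le_reg_l with (rise4 m); [exact p|].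
rewrite weight_shift_x by assumption.
assert (El := ks_lower_bound A B M e m n hA hB hM (fun i _ => h0 i)).
specialize (El ltac:(intros; apply IH; lia)).
assert (Et := IH m ltac:(lia) (S n)). rewrite weight_shift_t in Et by assumption.
assert (E : rise4 m * e (m + 4)%nat n = - (e m (S n) + ks_lower e m n))
  by (rewrite he; ring).
rewrite <- (Rabs_pos_eq (rise4 m)) at 1 by lra.
rewrite <- Rabs_mult, E, Rabs_Ropp.
eapply Rle_trans; [apply Rabs_triang|].
eapply Rle_trans; [apply Rplus_le_compat; [exact Et|exact El]|].
rewrite <- Rmult_plus_distr_l.
apply Rmult_le_compat_l; [apply weight_unit_ge0; assumption|].
assert (hc := cubic_ge m n). assert (hn := pos_INR n). assert (hm := pos_INR m).
assert (iA : 0 < / A) by (apply Rinv_0_lt_compat; lra).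
assert (g : 0 <= cubic m n) by lra.
apply Rle_trans with (cubic m n * (A / B + / (12 * A) + M / 12)).
- rewrite !Rmult_plus_distr_l, !Rplus_assoc. apply Rplus_le_compat; [right; field; lra|].
  apply Rplus_le_compat.
  + rewrite Rinv_mult. unfold Rdiv. rewrite <- Rmult_assoc.
    apply Rmult_le_compat_r; lra.
  + unfold Rdiv. nra.
- apply Rmult_le_compat_l; assumption.
Qed.

(** Solving in t: now the dominant term is y_xxxx, and the condition bounds B from
    above. *)
Lemma ks_bound_t (A B M : R) (e : nat -> nat -> R) :
  0 < A -> 0 < B -> 0 <= M -> / A ^ 3 + / (12 * A) + M / 12 <= A / B ->
  ks_array e -> (forall n, e 0%nat n = 0) ->
  (forall k, Rabs (e k 0%nat) <= weight A B M k 0) ->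
  forall n k, Rabs (e k n) <= weight A B M k n.
Proof.
intros hA hB hM hAB he h0 h n.
induction n as [n IH] using lt_wf_ind; intros k.
destruct n as [|n]; [apply h|].
assert (El := ks_lower_bound A B M e k n hA hB hM (fun i _ => h0 i)).
specialize (El ltac:(intros; apply IH; lia)).
assert (Et := IH n ltac:(lia) (k + 4)%nat).
assert (p := rise4_pos k).
apply (Rmult_le_compat_l (rise4 k)) in Et; [|lra].
rewrite weight_shift_x in Et by assumption.
rewrite weight_shift_t, he, Rabs_Ropp by assumption.
eapply Rle_trans; [apply Rabs_triang|].
rewrite Rabs_mult, (Rabs_pos_eq (rise4 k)) by lra.
eapply Rle_trans; [apply Rplus_le_compat; [exact Et|exact El]|].
rewrite <- Rmult_plus_distr_l.
apply Rmult_le_compat_l; [apply weight_unit_ge0; assumption|].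
assert (hc := cubic_ge k n). assert (hn := pos_INR n). assert (hk := pos_INR k).
assert (iA : 0 < / A) by (apply Rinv_0_lt_compat; lra).
assert (g : 0 <= cubic k n) by lra.
apply Rle_trans with (cubic k n * (/ A ^ 3 + / (12 * A) + M / 12)).
- rewrite !Rmult_plus_distr_l, !Rplus_assoc. apply Rplus_le_compat; [right; field; lra|].
  apply Rplus_le_compat.
  + rewrite Rinv_mult. unfold Rdiv. rewrite <- Rmult_assoc.
    apply Rmult_le_compat_r; lra.
  + unfold Rdiv. nra.
- unfold Rdiv in *. rewrite Rmult_assoc. apply Rmult_le_compat_l; assumption.
Qed.

(** * Coefficients generated by initial or by lateral data *)

(** Recursion where step n may use all the previous values: the table of length n
    agrees with the final function below n. *)
Fixpoint strong_table {X : Type} (step : (nat -> X) -> nat -> X) (x0 : X) (n : nat)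
  : nat -> X :=
  match n with
  | O => fun _ => x0
  | S m => fun i =>
      if Nat.eqb i m then step (strong_table step x0 m) m else strong_table step x0 m i
  end.

Definition strong_rec {X : Type} (step : (nat -> X) -> nat -> X) (x0 : X) (n : nat) : X :=
  step (strong_table step x0 n) n.

Lemma strong_table_eq {X : Type} (step : (nat -> X) -> nat -> X) (x0 : X) (n i : nat) :
  (i < n)%nat -> strong_table step x0 n i = strong_rec step x0 i.
Proof.
induction n as [|n IH]; intros h; [lia|]. simpl.
destruct (Nat.eqb_spec i n) as [->|ne]; [reflexivity|apply IH; lia].
Qed.

Definition jets_step (alpha : nat -> R) (f : nat -> nat -> R) (n : nat) : nat -> R :=
  match n with
  | O => alpha
  | S m => fun k =>
      - (rise4 k * f m (k + 4)%nat + ks_lower (fun j i => f i j) k m)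
  end.

Definition initial_jets (alpha : nat -> R) (k n : nat) : R :=
  strong_rec (jets_step alpha) (fun _ => 0) n k.

Lemma ks_lower_ext (e e' : nat -> nat -> R) (k n : nat) :
  (forall j i, (j <= k + 2)%nat -> (i <= n)%nat -> e j i = e' j i) ->
  ks_lower e k n = ks_lower e' k n.
Proof.
intros h. unfold ks_lower. rewrite h by lia. f_equal.
apply sum_eq; intros j hj. f_equal.
apply leibniz_ext; intros; apply h; lia.
Qed.

Lemma initial_jets_ks (alpha : nat -> R) : ks_array (initial_jets alpha).
Proof.
intros k n. unfold initial_jets at 1, strong_rec. simpl jets_step.
f_equal. f_equal.
- f_equal. rewrite Nat.eqb_refl. reflexivity.
- apply ks_lower_ext; intros j i hj hi.
  destruct (Nat.eqb_spec i n) as [->|ne]; [reflexivity|].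
  rewrite strong_table_eq by lia. reflexivity.
Qed.

Lemma initial_jets_0 (alpha : nat -> R) (k : nat) : initial_jets alpha k 0 = alpha k.
Proof. reflexivity. Qed.

Lemma initial_jets_even (alpha : nat -> R) :
  (forall k, Nat.Even k -> alpha k = 0) ->
  forall n k, Nat.Even k -> initial_jets alpha k n = 0.
Proof.
intros h n. induction n as [n IH] using lt_wf_ind; intros k hk.
destruct n as [|n]; [apply h; exact hk|].
rewrite initial_jets_ks, IH, ks_lower_even; [ring|exact hk| |lia|].
- intros j i hi hj. apply IH; [lia|exact hj].
- destruct hk as [l ->]. exists (l + 2)%nat; lia.
Qed.

Definition lateral_step (g1 g3 : nat -> R -> R) (f : nat -> nat -> R -> R) (k : nat)
  : nat -> R -> R :=
  match k with
  | 1%nat => g1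
  | 3%nat => g3
  | S (S (S (S k))) => fun n t =>
      - (f k (S n) t + ks_lower (fun j i => f j i t) k n) / rise4 k
  | _ => fun _ _ => 0
  end.

Definition lateral (g1 g3 : nat -> R -> R) : nat -> nat -> R -> R :=
  strong_rec (lateral_step g1 g3) (fun _ _ => 0).

Lemma lateral_succ4 (g1 g3 : nat -> R -> R) (k n : nat) (t : R) :
  lateral g1 g3 (k + 4) n t =
  - (lateral g1 g3 k (S n) t + ks_lower (fun j i => lateral g1 g3 j i t) k n) / rise4 k.
Proof.
replace (k + 4)%nat with (S (S (S (S k)))) by lia.
unfold lateral at 1, strong_rec.
change (lateral_step g1 g3 ?f (S (S (S (S k))))) with (fun n t =>
      - (f k (S n) t + ks_lower (fun j i => f j i t) k n) / rise4 k).
cbv beta.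
rewrite strong_table_eq by lia.
rewrite (ks_lower_ext _ (fun j i => lateral g1 g3 j i t)); [reflexivity|].
intros j i hj hi. rewrite strong_table_eq by lia. reflexivity.
Qed.

Lemma lateral_ks (g1 g3 : nat -> R -> R) (t : R) :
  ks_array (fun k n => lateral g1 g3 k n t).
Proof.
intros k n. rewrite lateral_succ4. assert (p := rise4_pos k). field; lra.
Qed.

(** * Uniform one-sided derivatives *)

(** A quadratic remainder, uniform on the interval.  It includes the one-sided
    derivatives at the endpoints and, unlike a pointwise derivative, is inherited by
    series when the constants are summable. *)
Definition taylor_on (a b C : R) (f f' : R -> R) : Prop :=
  forall s t, a <= s <= b -> a <= t <= b ->
    Rabs (f s - f t - (s - t) * f' t) <= C * (s - t) ^ 2.

Definition unif_deriv (a b : R) (f f' : R -> R) : Prop :=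
  exists C, taylor_on a b C f f'.

(** Limits of the neighbourhoods of t inside the interval: R is separated. *)
Lemma within_lim_unique (a b t x : R) : a <= t <= b ->
  is_filter_lim (within (fun u => a <= u <= b) (locally t)) x -> t = x.
Proof.
intros ht hx.
destruct (Req_dec t x) as [e|ne]; [exact e|exfalso].
assert (He : 0 < Rabs (t - x)) by (apply Rabs_pos_lt; lra).
destruct (hx _ (locally_ball x (mkposreal _ He))) as [d Hd].
assert (H : Rabs (t - x) < Rabs (t - x)) by exact (Hd t (ball_center t d) ht).
lra.
Qed.

Lemma taylor_on_is_derive (a b C : R) (f f' : R -> R) (t : R) :
  taylor_on a b C f f' -> a <= t <= b -> is_derive_on a b f t (f' t).
Proof.
intros h ht. assert (hlin : is_derive (fun u => u * f' t) t (f' t)) by (auto_derive; [exact I|ring]).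
split; [exact (proj1 hlin)|]. clear hlin.
intros x hx.
assert (E := within_lim_unique a b t x ht hx). subst x. clear hx.
intros eps. assert (he := cond_pos eps).
assert (hC : 0 < Rabs C + 1) by (assert (q := Rabs_pos C); lra).
assert (hd : 0 < eps / (Rabs C + 1)) by (apply Rdiv_lt_0_compat; lra).
exists (mkposreal _ hd). intros u hu hab.
change (Rabs (u - t) < eps / (Rabs C + 1)) in hu.
change (Rabs (f u - f t - (u - t) * f' t) <= eps * Rabs (u - t)).
eapply Rle_trans; [apply h; assumption|].
apply Rle_trans with ((Rabs C + 1) * (u - t) ^ 2).
{ apply Rmult_le_compat_r; [apply pow2_ge_0|]. assert (q := Rle_abs C); lra. }
rewrite <- pow2_abs. simpl pow. rewrite Rmult_1_r, <- Rmult_assoc.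
apply Rmult_le_compat_r; [apply Rabs_pos|].
apply Rmult_lt_compat_l with (r := Rabs C + 1) in hu; [|exact hC].
replace ((Rabs C + 1) * (eps / (Rabs C + 1))) with (pos eps) in hu by (field; lra).
lra.
Qed.

Lemma unif_deriv_bounded (a b : R) (f f' : R -> R) : a <= b ->
  unif_deriv a b f f' -> exists M, 0 <= M /\ forall t, a <= t <= b -> Rabs (f t) <= M.
Proof.
intros hab [C h].
exists (Rabs (f a) + (b - a) * Rabs (f' a) + Rabs C * (b - a) ^ 2).
assert (q1 := Rabs_pos (f a)). assert (q2 := Rabs_pos (f' a)). assert (q3 := Rabs_pos C).
split.
- repeat apply Rplus_le_le_0_compat; try apply Rmult_le_pos; try apply pow2_ge_0; lra.
- intros t ht.
  assert (E := h t a ltac:(lra) ltac:(lra)).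
  replace (f t) with (f a + (t - a) * f' a + (f t - f a - (t - a) * f' a)) by ring.
  eapply Rle_trans; [apply Rabs_triang|]. apply Rplus_le_compat.
  + eapply Rle_trans; [apply Rabs_triang|]. apply Rplus_le_compat_l.
    rewrite Rabs_mult, (Rabs_pos_eq (t - a)) by lra.
    apply Rmult_le_compat_r; lra.
  + eapply Rle_trans; [exact E|]. apply Rle_trans with (Rabs C * (t - a) ^ 2).
    * apply Rmult_le_compat_r; [apply pow2_ge_0|apply Rle_abs].
    * apply Rmult_le_compat_l; [lra|]. apply pow_incr; lra.
Qed.

(** Mean value inequality with the sharp constant, without two-sided derivatives:
    halving the segment n times divides the quadratic error by 2^n. *)
Lemma unif_deriv_lipschitz (a b M : R) (f f' : R -> R) :
  unif_deriv a b f f' -> (forall t, a <= t <= b -> Rabs (f' t) <= M) ->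
  forall s t, a <= s <= b -> a <= t <= b -> Rabs (f s - f t) <= M * Rabs (s - t).
Proof.
intros [C0 h0] hM s t hs ht.
set (C := Rabs C0).
assert (hC : 0 <= C) by apply Rabs_pos.
assert (h : taylor_on a b C f f').
{ intros u v hu hv. eapply Rle_trans; [apply h0; assumption|].
  apply Rmult_le_compat_r; [apply pow2_ge_0|apply Rle_abs]. }
assert (K : forall n s t, a <= s <= b -> a <= t <= b ->
  Rabs (f s - f t) <= M * Rabs (s - t) + C * (s - t) ^ 2 * (/ 2) ^ n).
{ clear s t hs ht. induction n as [|n IH]; intros s t hs ht.
  - replace (f s - f t) with ((f s - f t - (s - t) * f' t) + (s - t) * f' t) by ring.
    eapply Rle_trans; [apply Rabs_triang|]. rewrite Rplus_comm. simpl pow.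
    apply Rplus_le_compat.
    + rewrite Rabs_mult, Rmult_comm. apply Rmult_le_compat_r; [apply Rabs_pos|auto].
    + rewrite Rmult_1_r. apply (h s t hs ht).
  - set (m := (s + t) / 2).
    assert (hm : a <= m <= b) by (unfold m; lra).
    assert (e1 := IH s m hs hm). assert (e2 := IH m t hm ht).
    replace (s - m) with ((s - t) / 2) in e1 by (unfold m; lra).
    replace (m - t) with ((s - t) / 2) in e2 by (unfold m; lra).
    replace (f s - f t) with ((f s - f m) + (f m - f t)) by ring.
    eapply Rle_trans; [apply Rabs_triang|].
    eapply Rle_trans; [apply Rplus_le_compat; [exact e1|exact e2]|].
    unfold Rdiv. rewrite Rabs_mult, (Rabs_pos_eq (/ 2)) by lra.
    right. simpl pow. field. }
apply Rnot_lt_le; intros hlt.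
set (d := Rabs (f s - f t) - M * Rabs (s - t)).
assert (hd : 0 < d) by (unfold d; lra).
set (L := C * (s - t) ^ 2 + 1).
assert (hL : 0 < L) by (unfold L; assert (q := pow2_ge_0 (s - t)); nra).
assert (hdL : 0 < d / L) by (apply Rdiv_lt_0_compat; lra).
destruct (pow_lt_1_zero (/ 2) ltac:(rewrite Rabs_pos_eq; lra) (d / L) hdL) as [N HN].
assert (E := HN N (le_n _)).
assert (pN : 0 < (/ 2) ^ N) by (apply pow_lt; lra).
rewrite Rabs_pos_eq in E by lra.
assert (F := K N s t hs ht).
apply (Rmult_lt_compat_l L) in E; [|exact hL].
replace (L * (d / L)) with d in E by (field; lra).
unfold L, d in *. lra.
Qed.

(** Subtracting the linear part at t leaves a function whose derivative is at most
    M |s-t| between s and t.  The explicit constant is what makes series summable. *)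
Lemma unif_deriv_taylor (a b M : R) (f f' f'' : R -> R) :
  unif_deriv a b f f' -> unif_deriv a b f' f'' ->
  (forall t, a <= t <= b -> Rabs (f'' t) <= M) -> taylor_on a b M f f'.
Proof.
intros h1 h2 hM s t hs ht.
assert (hmin : a <= Rmin s t) by (apply Rmin_glb; lra).
assert (hmax : Rmax s t <= b) by (apply Rmax_lub; lra).
assert (hM0 : 0 <= M) by (eapply Rle_trans; [apply Rabs_pos|apply (hM t ht)]).
assert (hL := unif_deriv_lipschitz a b M f' f'' h2 hM).
assert (h3 : unif_deriv (Rmin s t) (Rmax s t) (fun u => f u - u * f' t) (fun u => f' u - f' t)).
{ destruct h1 as [C h1]. exists C. intros u v hu hv.
  replace (f u - u * f' t - (f v - v * f' t) - (u - v) * (f' v - f' t)) with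
    (f u - f v - (u - v) * f' v) by ring.
  apply h1; lra. }
assert (E := unif_deriv_lipschitz _ _ (M * Rabs (s - t)) _ _ h3).
assert (i1 : Rmin s t <= s <= Rmax s t) by (split; [apply Rmin_l|apply Rmax_l]).
assert (i2 : Rmin s t <= t <= Rmax s t) by (split; [apply Rmin_r|apply Rmax_r]).
rewrite <- pow2_abs. simpl pow. rewrite Rmult_1_r, <- Rmult_assoc.
replace (f s - f t - (s - t) * f' t) with (f s - s * f' t - (f t - t * f' t)) by ring.
apply E; [|exact i1|exact i2].
intros u hu. eapply Rle_trans; [apply hL; lra|].
apply Rmult_le_compat_l; [exact hM0|].
revert hu. unfold Rmin, Rmax. destruct (Rle_dec s t); intros hu.
- rewrite <- Rabs_Ropp, <- (Rabs_Ropp (s - t)), !Rabs_pos_eq by lra. lra.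
- rewrite !Rabs_pos_eq by lra. lra.
Qed.

Lemma unif_deriv_ext (a b : R) (f f' g g' : R -> R) :
  (forall t, a <= t <= b -> f t = g t) -> (forall t, a <= t <= b -> f' t = g' t) ->
  unif_deriv a b f f' -> unif_deriv a b g g'.
Proof.
intros e e' [C h]. exists C. intros s t hs ht.
rewrite <- !e, <- e' by assumption. apply h; assumption.
Qed.

Lemma unif_deriv_const (a b c : R) : unif_deriv a b (fun _ => c) (fun _ => 0).
Proof.
exists 0. intros s t _ _. replace (c - c - (s - t) * 0) with 0 by ring.
rewrite Rabs_R0; lra.
Qed.

Lemma unif_deriv_plus (a b : R) (f f' g g' : R -> R) :
  unif_deriv a b f f' -> unif_deriv a b g g' ->
  unif_deriv a b (fun t => f t + g t) (fun t => f' t + g' t).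
Proof.
intros [C h] [C' h']. exists (C + C'). intros s t hs ht.
replace (f s + g s - (f t + g t) - (s - t) * (f' t + g' t)) with
  ((f s - f t - (s - t) * f' t) + (g s - g t - (s - t) * g' t)) by ring.
eapply Rle_trans; [apply Rabs_triang|]. rewrite Rmult_plus_distr_r.
apply Rplus_le_compat; auto.
Qed.

Lemma unif_deriv_scal (a b c : R) (f f' : R -> R) :
  unif_deriv a b f f' -> unif_deriv a b (fun t => c * f t) (fun t => c * f' t).
Proof.
intros [C h]. exists (Rabs c * C). intros s t hs ht.
replace (c * f s - c * f t - (s - t) * (c * f' t)) with
  (c * (f s - f t - (s - t) * f' t)) by ring.
rewrite Rabs_mult, Rmult_assoc. apply Rmult_le_compat_l; [apply Rabs_pos|auto].
Qed.

Lemma unif_deriv_mult (a b : R) (f f' f'' g g' g'' : R -> R) : a <= b ->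
  unif_deriv a b f f' -> unif_deriv a b f' f'' ->
  unif_deriv a b g g' -> unif_deriv a b g' g'' ->
  unif_deriv a b (fun t => f t * g t) (fun t => f' t * g t + f t * g' t).
Proof.
intros hab hf hf' hg hg'.
destruct (unif_deriv_bounded _ _ _ _ hab hf) as [M1 [p1 b1]].
destruct (unif_deriv_bounded _ _ _ _ hab hg) as [M2 [p2 b2]].
destruct (unif_deriv_bounded _ _ _ _ hab hf') as [M3 [p3 b3]].
destruct (unif_deriv_bounded _ _ _ _ hab hg') as [M4 [p4 b4]].
assert (lf := unif_deriv_lipschitz _ _ _ _ _ hf b3).
assert (lg := unif_deriv_lipschitz _ _ _ _ _ hg b4).
destruct hf as [C h]. destruct hg as [C' h'].
exists (C * M2 + M1 * C' + M3 * M4). intros s t hs ht.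
replace (f s * g s - f t * g t - (s - t) * (f' t * g t + f t * g' t)) with
  ((f s - f t - (s - t) * f' t) * g t + f t * (g s - g t - (s - t) * g' t)
   + (f s - f t) * (g s - g t)) by ring.
eapply Rle_trans; [apply Rabs_triang|].
rewrite Rmult_plus_distr_r. apply Rplus_le_compat.
- eapply Rle_trans; [apply Rabs_triang|].
  rewrite Rmult_plus_distr_r. apply Rplus_le_compat.
  + rewrite Rabs_mult. replace (C * M2 * (s - t) ^ 2) with (C * (s - t) ^ 2 * M2) by ring.
    apply Rmult_le_compat; auto using Rabs_pos.
  + rewrite Rabs_mult, Rmult_assoc.
    apply Rmult_le_compat; auto using Rabs_pos.
- rewrite Rabs_mult, <- pow2_abs.
  replace (M3 * M4 * Rabs (s - t) ^ 2) with ((M3 * Rabs (s - t)) * (M4 * Rabs (s - t))) by ring.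
  apply Rmult_le_compat; auto using Rabs_pos.
Qed.

Definition jets_on (a b : R) (F : nat -> R -> R) : Prop :=
  forall n, unif_deriv a b (F n) (F (S n)).

Lemma jets_on_taylor (a b M : R) (F : nat -> R -> R) (n : nat) :
  jets_on a b F -> (forall t, a <= t <= b -> Rabs (F (S (S n)) t) <= M) ->
  taylor_on a b M (F n) (F (S n)).
Proof. intros h hM. exact (unif_deriv_taylor _ _ _ _ _ _ (h n) (h (S n)) hM). Qed.

Lemma jets_on_plus (a b : R) (F G : nat -> R -> R) :
  jets_on a b F -> jets_on a b G -> jets_on a b (fun n t => F n t + G n t).
Proof. intros hF hG n. apply unif_deriv_plus; auto. Qed.

Lemma jets_on_leibniz (a b : R) (F G : nat -> R -> R) : a <= b ->
  jets_on a b F -> jets_on a b G ->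
  jets_on a b (fun n t => leibniz (fun i => F i t) (fun i => G i t) n).
Proof.
intros hab hF hG n. revert F G hF hG.
induction n as [|n IH]; intros F G hF hG.
- simpl. apply unif_deriv_mult with (F 2%nat) (G 2%nat); auto.
- apply (unif_deriv_plus a b
    (fun t => leibniz (fun i => F (S i) t) (fun i => G i t) n)
    (fun t => leibniz (fun i => F (S i) t) (fun i => G i t) (S n))
    (fun t => leibniz (fun i => F i t) (fun i => G (S i) t) n)
    (fun t => leibniz (fun i => F i t) (fun i => G (S i) t) (S n))).
  + apply (IH (fun i => F (S i)) G); [intros i; apply hF|exact hG].
  + apply (IH F (fun i => G (S i))); [exact hF|intros i; apply hG].
Qed.

Lemma jets_on_reflect (T : R) (F : nat -> R -> R) :
  jets_on 0 T F -> jets_on 0 T (fun n t => (-1) ^ n * F n (T - t)).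
Proof.
intros h n. destruct (h n) as [C hC]. exists C. intros s t hs ht.
replace ((-1) ^ n * F n (T - s) - (-1) ^ n * F n (T - t) -
  (s - t) * ((-1) ^ S n * F (S n) (T - t))) with
  ((-1) ^ n * (F n (T - s) - F n (T - t) - ((T - s) - (T - t)) * F (S n) (T - t)))
  by (simpl; ring).
rewrite Rabs_mult, pow_1_abs, Rmult_1_l.
replace ((s - t) ^ 2) with (((T - s) - (T - t)) ^ 2) by ring.
apply hC; lra.
Qed.

Lemma unif_deriv_sum (a b : R) (N : nat) (f f' : nat -> R -> R) :
  (forall i, (i <= N)%nat -> unif_deriv a b (f i) (f' i)) ->
  unif_deriv a b (fun t => sum_f_R0 (fun i => f i t) N) (fun t => sum_f_R0 (fun i => f' i t) N).
Proof.
induction N as [|N IH]; intros h; simpl.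
- apply h; lia.
- apply (unif_deriv_plus a b (fun t => sum_f_R0 (fun i => f i t) N)
    (fun t => sum_f_R0 (fun i => f' i t) N)); [apply IH; intros; apply h; lia|apply h; lia].
Qed.

Lemma ex_series_mult_l (c : R) (u : nat -> R) :
  ex_series u -> ex_series (fun n => c * u n).
Proof. intros h. exact (ex_series_scal (K := R_AbsRing) (V := R_NormedModule) c u h). Qed.

Lemma ex_series_sub (u v : nat -> R) :
  ex_series u -> ex_series v -> ex_series (fun n => u n - v n).
Proof. intros h h'. exact (ex_series_minus (K := R_AbsRing) (V := R_NormedModule) u v h h'). Qed.

Lemma Series_bound (u v : nat -> R) : (forall n, Rabs (u n) <= v n) -> ex_series v ->
  ex_series u /\ Rabs (Series u) <= Series v.
Proof.
intros h hv.
assert (hu : ex_series (fun n => Rabs (u n))).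
{ apply (ex_series_le (K := R_AbsRing) (V := R_CompleteNormedModule)) with v; [|exact hv].
  intros n. change (Rabs (Rabs (u n)) <= v n). rewrite Rabs_Rabsolu; apply h. }
split; [apply ex_series_Rabs, hu|].
eapply Rle_trans; [apply Series_Rabs, hu|].
apply Series_le; [|exact hv]. intros n; split; [apply Rabs_pos|apply h].
Qed.

Lemma taylor_on_series (a b : R) (f f' : nat -> R -> R) (v w c : nat -> R) :
  ex_series v -> ex_series w -> ex_series c ->
  (forall k t, a <= t <= b -> Rabs (f k t) <= v k) ->
  (forall k t, a <= t <= b -> Rabs (f' k t) <= w k) ->
  (forall k, taylor_on a b (c k) (f k) (f' k)) ->
  taylor_on a b (Series c) (fun t => Series (fun k => f k t)) (fun t => Series (fun k => f' k t)).
Proof.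
intros hv hw hc bf bf' h s t hs ht.
assert (es : ex_series (fun k => f k s)) by (apply (Series_bound _ v); auto).
assert (et : ex_series (fun k => f k t)) by (apply (Series_bound _ v); auto).
assert (et' : ex_series (fun k => f' k t)) by (apply (Series_bound _ w); auto).
assert (et2 : ex_series (fun k => (s - t) * f' k t))
  by (apply ex_series_mult_l, et').
rewrite <- Series_scal_l, <- Series_minus, <- Series_minus by
  (try apply ex_series_sub; assumption).
rewrite (Rmult_comm (Series c)), <- Series_scal_l.
apply Series_bound; [|apply ex_series_mult_l, hc].
intros k. rewrite (Rmult_comm ((s - t) ^ 2)). apply h; assumption.
Qed.

Definition extend0 (l : R) (f : R -> R) (t : R) : R := if Rle_dec t 0 then l else f t.

Lemma extend0_pos (l : R) (f : R -> R) (t : R) : 0 < t -> extend0 l f t = f t.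
Proof. intros h; unfold extend0. destruct (Rle_dec t 0); [lra|reflexivity]. Qed.

Lemma extend0_0 (l : R) (f : R -> R) : extend0 l f 0 = l.
Proof. unfold extend0. destruct (Rle_dec 0 0); [reflexivity|lra]. Qed.

Lemma Rle_of_small (x y K : R) :
  (forall e, 0 < e < 1 -> x <= y + K * e) -> x <= y.
Proof.
intros h. apply Rnot_lt_le; intros hlt.
set (K' := Rabs K + 1). assert (hK : 1 <= K') by (unfold K'; assert (q := Rabs_pos K); lra).
set (e := Rmin (1 / 2) ((x - y) / (2 * K'))).
assert (e0 : 0 < e).
{ apply Rmin_glb_lt; [lra|]. apply Rdiv_lt_0_compat; lra. }
assert (e1 := Rmin_l (1 / 2) ((x - y) / (2 * K'))).
assert (e2 := Rmin_r (1 / 2) ((x - y) / (2 * K'))). fold e in e1, e2.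
assert (H := h e ltac:(lra)).
assert (K * e <= K' * e) by (apply Rmult_le_compat_r; [lra|unfold K'; assert (q := Rle_abs K); lra]).
apply (Rmult_le_compat_l K') in e2; [|lra].
replace (K' * ((x - y) / (2 * K'))) with ((x - y) / 2) in e2 by (field; lra).
lra.
Qed.

Lemma MVT_is_derive (f f' : R -> R) (s t : R) :
  (forall u, Rmin t s <= u <= Rmax t s -> is_derive f u (f' u)) ->
  exists c, Rmin t s <= c <= Rmax t s /\ f s - f t = f' c * (s - t).
Proof.
intros h. apply MVT_gen.
- intros u hu. apply h; lra.
- intros u hu. apply derivable_continuous_pt. exists (f' u).
  apply is_derive_Reals, h, hu.
Qed.

Lemma between_dist (c s t : R) : Rmin t s <= c <= Rmax t s -> Rabs (c - t) <= Rabs (s - t).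
Proof.
unfold Rmin, Rmax. destruct (Rle_dec t s); intros hc.
- rewrite !Rabs_pos_eq; lra.
- rewrite <- Rabs_Ropp, <- (Rabs_Ropp (s - t)), !Rabs_pos_eq by lra. lra.
Qed.

(** A function on t > 0 with bounded derivatives that have limits at 0 is smooth up
    to 0: the Taylor inequality on t > 0 passes to the limit. *)
Lemma extend0_jets (F : nat -> R -> R) (l B : nat -> R) :
  (forall n t, 0 < t -> is_derive (F n) t (F (S n) t)) ->
  (forall n t, 0 < t -> Rabs (F n t) <= B n) ->
  (forall n, exists C, forall t, 0 < t < 1 -> Rabs (F n t - l n) <= C * t) ->
  (forall n t, 0 <= t -> Rabs (extend0 (l n) (F n) t) <= B n) /\
  forall n b, taylor_on 0 b (B (S (S n))) (extend0 (l n) (F n)) (extend0 (l (S n)) (F (S n))).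
Proof.
intros hd hB hl.
assert (lip : forall n s t, 0 < s -> 0 < t -> Rabs (F n s - F n t) <= B (S n) * Rabs (s - t)).
{ intros n s t hs ht.
  assert (q := Rmin_glb_lt t s 0 ht hs).
  destruct (MVT_is_derive (F n) (F (S n)) s t) as [c [hc E]].
  - intros x hx. apply hd. lra.
  - rewrite E, Rabs_mult. apply Rmult_le_compat_r; [apply Rabs_pos|].
    apply hB. lra. }
assert (tay : forall n s t, 0 < s -> 0 < t ->
  Rabs (F n s - F n t - (s - t) * F (S n) t) <= B (S (S n)) * (s - t) ^ 2).
{ intros n s t hs ht.
  assert (q := Rmin_glb_lt t s 0 ht hs).
  destruct (MVT_is_derive (F n) (F (S n)) s t) as [c [hc E]].
  - intros x hx. apply hd. lra.
  - assert (hc0 : 0 < c) by lra.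
    rewrite E. replace (F (S n) c * (s - t) - (s - t) * F (S n) t) with
      ((F (S n) c - F (S n) t) * (s - t)) by ring.
    rewrite Rabs_mult, <- pow2_abs. simpl pow. rewrite Rmult_1_r, <- Rmult_assoc.
    apply Rmult_le_compat_r; [apply Rabs_pos|].
    eapply Rle_trans; [apply lip; assumption|].
    apply Rmult_le_compat_l.
    + eapply Rle_trans; [apply Rabs_pos|apply (hB (S (S n)) t ht)].
    + apply between_dist, hc. }
assert (bd : forall n t, 0 <= t -> Rabs (extend0 (l n) (F n) t) <= B n).
{ intros n t ht. destruct ht as [ht|<-]; [rewrite extend0_pos; auto|].
  rewrite extend0_0. destruct (hl n) as [C hC].
  apply Rle_of_small with C. intros e he.
  replace (l n) with (F n e - (F n e - l n)) by ring.
  eapply Rle_trans; [apply Rabs_triang|]. rewrite Rabs_Ropp.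
  apply Rplus_le_compat; [apply hB; lra|apply hC; lra]. }
split; [exact bd|].
intros n b s t [hs _] [ht _].
destruct hs as [hs|<-]; destruct ht as [ht|<-].
- rewrite !extend0_pos by assumption. auto.
- rewrite !(extend0_pos _ _ s), !extend0_0 by assumption.
  destruct (hl n) as [C hC]. destruct (hl (S n)) as [C' hC'].
  apply Rle_of_small with (C + B (S n) + s * C' + B (S (S n)) * 1). intros e he.
  assert (e1 := tay n s e hs ltac:(lra)). assert (e2 := hC e he). assert (e3 := hC' e he).
  assert (e4 := hB (S n) e ltac:(lra)).
  replace (F n s - l n - (s - 0) * l (S n)) with
    ((F n s - F n e - (s - e) * F (S n) e) + (F n e - l n) - e * F (S n) e
     + s * (F (S n) e - l (S n))) by ring.
  assert (b4 : Rabs (e * F (S n) e) <= e * B (S n)).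
  { rewrite Rabs_mult, Rabs_pos_eq by lra. apply Rmult_le_compat_l; lra. }
  assert (b3 : Rabs (s * (F (S n) e - l (S n))) <= s * (C' * e)).
  { rewrite Rabs_mult, Rabs_pos_eq by lra. apply Rmult_le_compat_l; lra. }
  eapply Rle_trans; [apply Rabs_triang|].
  eapply Rle_trans; [apply Rplus_le_compat_r, Rabs_triang|].
  eapply Rle_trans; [apply Rplus_le_compat_r, Rplus_le_compat_r, Rabs_triang|].
  rewrite Rabs_Ropp.
  assert (hBp : 0 <= B (S (S n))) by (eapply Rle_trans; [apply Rabs_pos|apply (hB _ s hs)]).
  assert (B (S (S n)) * (s - e) ^ 2 <= B (S (S n)) * (s - 0) ^ 2 + B (S (S n)) * 1 * e).
  { replace (B (S (S n)) * (s - 0) ^ 2 + B (S (S n)) * 1 * e) with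
      (B (S (S n)) * (s ^ 2 + e)) by ring.
    apply Rmult_le_compat_l; [exact hBp|]. nra. }
  lra.
- rewrite !(extend0_pos _ _ t), !extend0_0 by assumption.
  destruct (hl n) as [C hC].
  apply Rle_of_small with (C + B (S n) + B (S (S n)) * 1). intros e he.
  assert (e1 := tay n e t ltac:(lra) ht). assert (e2 := hC e he).
  assert (e4 := hB (S n) t ltac:(lra)).
  replace (l n - F n t - (0 - t) * F (S n) t) with
    ((F n e - F n t - (e - t) * F (S n) t) - (F n e - l n) + e * F (S n) t) by ring.
  assert (b4 : Rabs (e * F (S n) t) <= e * B (S n)).
  { rewrite Rabs_mult, Rabs_pos_eq by lra. apply Rmult_le_compat_l; lra. }
  eapply Rle_trans; [apply Rabs_triang|].
  eapply Rle_trans; [apply Rplus_le_compat_r, Rabs_triang|].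
  rewrite Rabs_Ropp.
  assert (hBp : 0 <= B (S (S n))) by (eapply Rle_trans; [apply Rabs_pos|apply (hB _ t ht)]).
  assert (B (S (S n)) * (e - t) ^ 2 <= B (S (S n)) * (0 - t) ^ 2 + B (S (S n)) * 1 * e).
  { replace (B (S (S n)) * (0 - t) ^ 2 + B (S (S n)) * 1 * e) with
      (B (S (S n)) * (t ^ 2 + e)) by ring.
    apply Rmult_le_compat_l; [exact hBp|]. nra. }
  lra.
- rewrite !extend0_0. replace (l n - l n - (0 - 0) * l (S n)) with 0 by ring.
  rewrite Rabs_R0. right; ring.
Qed.

(** * Truncated Laplace transforms of monomials *)

Lemma is_derive_eq (f : R -> R) (x l l' : R) : is_derive f x l -> l = l' -> is_derive f x l'.
Proof. intros h <-; exact h. Qed.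

(** (a / t)^(1/3). *)
Definition zeta (a t : R) : R := exp ((ln a - ln t) / 3).

Lemma zeta_pos (a t : R) : 0 < zeta a t.
Proof. apply exp_pos. Qed.

Lemma zeta_cube (a t : R) : 0 < a -> 0 < t -> zeta a t ^ 3 * t = a.
Proof.
intros ha ht. unfold zeta. simpl pow. rewrite Rmult_1_r, <- !exp_plus.
replace ((ln a - ln t) / 3 + ((ln a - ln t) / 3 + (ln a - ln t) / 3)) with (ln a + - ln t)
  by field.
rewrite exp_plus, exp_Ropp, !exp_ln by assumption. field; lra.
Qed.

Lemma zeta_derive (a t : R) : 0 < a -> 0 < t ->
  is_derive (zeta a) t (- zeta a t ^ 4 / (3 * a)).
Proof.
intros ha ht. apply is_derive_eq with (- / t / 3 * zeta a t).
- unfold zeta, Rminus, Rdiv. auto_derive; [exact ht|]. field; lra.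
- assert (E := zeta_cube a t ha ht). assert (p := zeta_pos a t).
  replace (zeta a t ^ 4) with (zeta a t ^ 3 * zeta a t) by ring.
  replace (zeta a t ^ 3) with (a / t); [field; lra|].
  apply Rmult_eq_reg_r with t; [rewrite E; field; lra|lra].
Qed.

(** The q-th derivative of z^m e^{-z} with z = (a/t)^(1/3); since
    dz/dt = - z^4 / (3a), differentiation stays in this family. *)
Fixpoint flat (a : R) (q m : nat) (t : R) : R :=
  match q with
  | O => zeta a t ^ m * exp (- zeta a t)
  | S q => (flat a q (m + 4) t - INR m * flat a q (m + 3) t) / (3 * a)
  end.

Lemma flat_derive (a : R) (q m : nat) (t : R) : 0 < a -> 0 < t ->
  is_derive (flat a q m) t (flat a (S q) m t).
Proof.
intros ha ht. revert m. induction q as [|q IH]; intros m.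
- assert (D := zeta_derive a t ha ht).
  simpl flat.
  apply is_derive_eq with (- zeta a t ^ 4 / (3 * a) *
    (INR m * zeta a t ^ pred m * exp (- zeta a t) - zeta a t ^ m * exp (- zeta a t))).
  + apply (is_derive_comp (fun z => z ^ m * exp (- z)) (zeta a)); [|exact D].
    auto_derive; [exact I|]. ring.
  + rewrite !pow_add. destruct m as [|m].
    * simpl INR. simpl pow. field; lra.
    * rewrite S_INR. simpl pred. simpl pow. field; lra.
- change (flat a (S (S q)) m t) with
    ((flat a (S q) (m + 4) t - INR m * flat a (S q) (m + 3) t) / (3 * a)).
  apply is_derive_ext with (fun t => / (3 * a) * (flat a q (m + 4) t - INR m * flat a q (m + 3) t)).
  { intros x. simpl. unfold Rdiv. ring. }
  apply is_derive_eq with (/ (3 * a) *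
    (flat a (S q) (m + 4) t - INR m * flat a (S q) (m + 3) t)); [|unfold Rdiv; ring].
  apply is_derive_scal.
  apply (is_derive_minus (K := R_AbsRing) (V := R_NormedModule)); [apply IH|].
  apply is_derive_scal, IH.
Qed.

Lemma pow_exp_le_fact (m : nat) (z : R) : 0 <= z -> z ^ m * exp (- z) <= INR (fact m).
Proof.
intros hz. assert (h := exp_ge_taylor z m hz).
assert (q := INR_fact_pos m).
assert (h1 : z ^ m / INR (fact m) <= exp z).
{ eapply Rle_trans; [|exact h]. destruct m as [|m]; [simpl; lra|].
  rewrite tech5.
  assert (0 <= sum_f_R0 (fun k => z ^ k / INR (fact k)) m); [|lra].
  apply cond_pos_sum; intros n. apply Rmult_le_pos; [apply pow_le, hz|].
  left; apply Rinv_0_lt_compat, INR_fact_pos. }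
rewrite exp_Ropp. assert (p := exp_pos z).
apply Rmult_le_reg_r with (exp z); [exact p|].
rewrite Rmult_assoc, Rinv_l, Rmult_1_r by lra.
apply Rmult_le_compat_l with (r := INR (fact m)) in h1; [|lra].
replace (INR (fact m) * (z ^ m / INR (fact m))) with (z ^ m) in h1 by (field; lra).
exact h1.
Qed.

(** Each derivative produces two terms of weight 1/(3a), and a power of z below e^{-z}
    is bounded by a factorial: derivatives of order 4 in the Gevrey scale, with a radius
    proportional to a. *)
Lemma flat_bound (a : R) (q m : nat) (t : R) : 0 < a -> 0 < t ->
  Rabs (flat a q m t) <= (2 / (3 * a)) ^ q * INR (fact (m + 4 * q)).
Proof.
intros ha ht. revert m. induction q as [|q IH]; intros m.
- simpl flat. rewrite Rabs_pos_eq.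
  + rewrite Nat.mul_0_r, Nat.add_0_r. simpl pow. rewrite Rmult_1_l.
    apply pow_exp_le_fact. left; apply zeta_pos.
  + apply Rmult_le_pos; [apply pow_le; left; apply zeta_pos|left; apply exp_pos].
- simpl flat. unfold Rdiv at 1. rewrite Rabs_mult.
  assert (i0 : 0 < / (3 * a)) by (apply Rinv_0_lt_compat; lra).
  rewrite (Rabs_pos_eq (/ (3 * a))) by lra.
  assert (h1 := IH (m + 4)%nat). assert (h2 := IH (m + 3)%nat).
  replace (m + 4 * S q)%nat with (m + 4 + 4 * q)%nat by lia.
  set (X := (2 / (3 * a)) ^ q) in *.
  assert (hX : 0 <= X) by (apply pow_le; unfold Rdiv; nra).
  replace (2 / (3 * a)) with (2 * / (3 * a)) by reflexivity.
  apply Rle_trans with (2 * (X * INR (fact (m + 4 + 4 * q))) * / (3 * a)).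
  + apply Rmult_le_compat_r; [lra|].
    eapply Rle_trans; [apply Rabs_triang|].
    rewrite Rabs_Ropp, Rabs_mult, (Rabs_pos_eq (INR m)) by apply pos_INR.
    assert (INR m * Rabs (flat a q (m + 3) t) <= X * INR (fact (m + 4 + 4 * q))); [|lra].
    eapply Rle_trans; [apply Rmult_le_compat_l; [apply pos_INR|exact h2]|].
    replace (m + 4 + 4 * q)%nat with (S (m + 3 + 4 * q)) by lia.
    rewrite INR_fact_S. rewrite <- Rmult_assoc, (Rmult_comm (INR m)), Rmult_assoc.
    apply Rmult_le_compat_l; [exact hX|].
    apply Rmult_le_compat_r; [left; apply INR_fact_pos|].
    rewrite !plus_INR. assert (g := pos_INR 3). assert (g' := pos_INR (4 * q)). lra.
  + unfold X. right. simpl pow. unfold Rdiv. ring.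
Qed.

Lemma flat_small (a : R) (q m : nat) : 0 < a ->
  exists C, 0 <= C /\ forall t, 0 < t -> Rabs (flat a q m t) <= C * t.
Proof.
intros ha. revert m. induction q as [|q IH]; intros m.
- exists (INR (fact (m + 3)) / a).
  assert (p := INR_fact_pos (m + 3)).
  split; [left; apply Rdiv_lt_0_compat; lra|].
  intros t ht.
  assert (h := flat_bound a 0 (m + 3) t ha ht).
  rewrite Nat.mul_0_r, Nat.add_0_r in h. simpl pow in h. rewrite Rmult_1_l in h.
  assert (E : flat a 0 m t = flat a 0 (m + 3) t * t / a).
  { simpl flat. rewrite pow_add. assert (Ez := zeta_cube a t ha ht).
    transitivity (zeta a t ^ m * exp (- zeta a t) * (zeta a t ^ 3 * t) / a);
      [rewrite Ez|]; field; lra. }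
  rewrite E. unfold Rdiv. rewrite !Rabs_mult, (Rabs_pos_eq t), (Rabs_pos_eq (/ a)) by
    (try left; try apply Rinv_0_lt_compat; lra).
  assert (i0 : 0 < / a) by (apply Rinv_0_lt_compat; lra).
  replace (INR (fact (m + 3)) * / a * t) with (INR (fact (m + 3)) * t * / a) by ring.
  apply Rmult_le_compat_r; [lra|]. apply Rmult_le_compat_r; lra.
- destruct (IH (m + 4)%nat) as [C1 [p1 h1]]. destruct (IH (m + 3)%nat) as [C2 [p2 h2]].
  assert (i0 : 0 < / (3 * a)) by (apply Rinv_0_lt_compat; lra).
  assert (pm := pos_INR m).
  exists ((C1 + INR m * C2) * / (3 * a)). split; [apply Rmult_le_pos; nra|].
  intros t ht. simpl flat. unfold Rdiv. rewrite Rabs_mult, (Rabs_pos_eq (/ _)) by lra.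
  replace ((C1 + INR m * C2) * / (3 * a) * t) with ((C1 * t + INR m * (C2 * t)) * / (3 * a)) by ring.
  apply Rmult_le_compat_r; [lra|].
  eapply Rle_trans; [apply Rabs_triang|].
  rewrite Rabs_Ropp, Rabs_mult, (Rabs_pos_eq (INR m)) by exact pm.
  apply Rplus_le_compat; [auto|]. apply Rmult_le_compat_l; auto.
Qed.

(** 1 - e^{-z} sum_{j<=m} z^j/j!, that is, the integral of s^m e^{-s} / m! over
    0 < s < z. *)
Fixpoint exp_rem (m : nat) (z : R) : R :=
  match m with
  | O => 1 - exp (- z)
  | S m => exp_rem m z - z ^ S m * exp (- z) / INR (fact (S m))
  end.

Lemma exp_rem_derive (m : nat) (z : R) :
  is_derive (exp_rem m) z (z ^ m * exp (- z) / INR (fact m)).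
Proof.
induction m as [|m IH].
- simpl exp_rem. auto_derive; [exact I|]. simpl. field.
- assert (p := INR_fact_pos m). assert (p' := INR_fact_pos (S m)).
  assert (pm := pos_INR m).
  apply is_derive_eq with (z ^ m * exp (- z) / INR (fact m) -
    ((INR m + 1) * z ^ m - z ^ S m) * exp (- z) / INR (fact (S m))).
  + apply (is_derive_minus (K := R_AbsRing) (V := R_NormedModule)); [exact IH|].
    auto_derive; [exact I|]. change (Nat.pred (S m)) with m.
    rewrite ?S_INR. simpl pow. unfold Rdiv.
    destruct m as [|m]; [simpl; field|]. rewrite ?S_INR. simpl; ring.
  + rewrite INR_fact_S in *. field. split; lra.
Qed.

Lemma exp_rem_0 (m : nat) : exp_rem m 0 = 0.
Proof.
induction m as [|m IH]; simpl exp_rem.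
- rewrite Ropp_0, exp_0; ring.
- rewrite IH. simpl pow. unfold Rdiv; ring.
Qed.

Lemma ge0_of_derive (f f' : R -> R) (z : R) :
  (forall x, is_derive f x (f' x)) -> (forall x, 0 <= x -> 0 <= f' x) -> f 0 = 0 ->
  0 <= z -> 0 <= f z.
Proof.
intros hd h h0 hz.
destruct (MVT_is_derive f f' z 0) as [c [hc E]].
- intros; apply hd.
- rewrite Rmin_left, Rmax_right in hc by lra. rewrite h0 in E.
  assert (q := h c (proj1 hc)). assert (0 <= f' c * (z - 0)) by (apply Rmult_le_pos; lra). lra.
Qed.

Lemma exp_rem_ge0 (m : nat) (z : R) : 0 <= z -> 0 <= exp_rem m z.
Proof.
apply ge0_of_derive with (fun z => z ^ m * exp (- z) / INR (fact m)).
- intros x; apply exp_rem_derive.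
- intros x hx. apply Rmult_le_pos.
  + apply Rmult_le_pos; [apply pow_le, hx|left; apply exp_pos].
  + left; apply Rinv_0_lt_compat, INR_fact_pos.
- apply exp_rem_0.
Qed.

Lemma exp_rem_le1 (m : nat) (z : R) : 0 <= z -> exp_rem m z <= 1.
Proof.
intros hz. induction m as [|m IH].
- simpl. assert (q := exp_pos (- z)); lra.
- change (exp_rem (S m) z) with (exp_rem m z - z ^ S m * exp (- z) / INR (fact (S m))).
  assert (0 <= z ^ S m * exp (- z) / INR (fact (S m))); [|lra].
  apply Rmult_le_pos.
  + apply Rmult_le_pos; [apply pow_le, hz|left; apply exp_pos].
  + left; apply Rinv_0_lt_compat, INR_fact_pos.
Qed.

(** In the integral for the index m + 1, bound one factor s by z. *)
Lemma exp_rem_S_le (m : nat) (z : R) : 0 <= z ->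
  (INR m + 1) * exp_rem (S m) z <= z * exp_rem m z.
Proof.
intros hz.
assert (h : 0 <= z * exp_rem m z - (INR m + 1) * exp_rem (S m) z); [|lra].
apply (ge0_of_derive (fun z => z * exp_rem m z - (INR m + 1) * exp_rem (S m) z) (exp_rem m)).
- intros x.
  apply is_derive_eq with ((1 * exp_rem m x + x * (x ^ m * exp (- x) / INR (fact m)))
     - (INR m + 1) * (x ^ S m * exp (- x) / INR (fact (S m)))).
  + apply (is_derive_minus (K := R_AbsRing) (V := R_NormedModule)).
    * apply (is_derive_mult (fun x => x) (exp_rem m)).
      -- apply (is_derive_id (K := R_AbsRing)).
      -- apply exp_rem_derive.
      -- intros; apply Rmult_comm.
    * apply is_derive_scal, exp_rem_derive.
  + rewrite INR_fact_S. assert (p := INR_fact_pos m). assert (pm := pos_INR m).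
    simpl pow. field. split; lra.
- intros; apply exp_rem_ge0; assumption.
- rewrite !exp_rem_0; ring.
- exact hz.
Qed.

Lemma exp_rem_add_le (m k : nat) (z : R) : 0 <= z ->
  INR (fact (m + k)) * exp_rem (m + k) z <= z ^ k * INR (fact m).
Proof.
intros hz.
induction k as [|k IH].
- rewrite Nat.add_0_r. simpl pow. assert (h := exp_rem_le1 m z hz).
  assert (p := INR_fact_pos m). nra.
- rewrite Nat.add_succ_r, INR_fact_S.
  assert (h := exp_rem_S_le (m + k) z hz). assert (p := INR_fact_pos (m + k)).
  apply Rle_trans with (z * (INR (fact (m + k)) * exp_rem (m + k) z)).
  + rewrite (Rmult_comm (INR (m + k) + 1)), Rmult_assoc.
    rewrite <- Rmult_assoc, (Rmult_comm z), Rmult_assoc.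
    rewrite Rmult_assoc. apply Rmult_le_compat_l; lra.
  + simpl pow. rewrite Rmult_assoc. apply Rmult_le_compat_l; assumption.
Qed.

Lemma exp_rem_small (a : R) (m : nat) : 0 < a ->
  exists C, 0 <= C /\ forall t, 0 < t -> Rabs (exp_rem m (zeta a t) - 1) <= C * t.
Proof.
intros ha. induction m as [|m [C [hC h]]].
- destruct (flat_small a 0 0 ha) as [C [hC h]]. exists C; split; [exact hC|].
  intros t ht. eapply Rle_trans; [|apply h, ht]. simpl. right.
  rewrite <- Rabs_Ropp. f_equal. ring.
- destruct (flat_small a 0 (S m) ha) as [C' [hC' h']].
  assert (i0 : 0 < / INR (fact (S m))) by apply Rinv_0_lt_compat, INR_fact_pos.
  exists (C + C' * / INR (fact (S m))). split; [nra|].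
  intros t ht.
  change (exp_rem (S m) (zeta a t)) with
    (exp_rem m (zeta a t) - flat a 0 (S m) t * / INR (fact (S m))).
  replace (exp_rem m (zeta a t) - flat a 0 (S m) t * / INR (fact (S m)) - 1) with
    ((exp_rem m (zeta a t) - 1) - flat a 0 (S m) t * / INR (fact (S m))) by ring.
  eapply Rle_trans; [apply Rabs_triang|].
  rewrite Rabs_Ropp, Rabs_mult, (Rabs_pos_eq (/ _)) by lra.
  rewrite Rmult_plus_distr_r. apply Rplus_le_compat; [apply h, ht|].
  replace (C' * / INR (fact (S m)) * t) with (C' * t * / INR (fact (S m))) by ring.
  apply Rmult_le_compat_r; [lra|apply h', ht].
Qed.

(** The term produced by the moving endpoint of the truncated integral when the
    i-th derivative is differentiated once more. *)
Definition boundary_coef (a : R) (n i : nat) : R :=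
  if Nat.leb i n then a ^ (n - i) / (3 * a * INR (fact (n - i)) * INR (fact (3 * n))) else 0.

(** The q-th derivative of the sum of all endpoint terms that have appeared in the
    first p derivatives. *)
Fixpoint boundary (a : R) (n p q : nat) (t : R) : R :=
  match p with
  | O => 0
  | S p => boundary a n p (S q) t + boundary_coef a n p * flat a q (3 * p + 4) t
  end.

(** The p-th derivative of t^n/n! times [exp_rem] of index 3n at (a/t)^(1/3): the
    integral of (t s^3)^n e^{-s} / (n! (3n)!) over 0 < s < (a/t)^(1/3). *)
Definition cut_monomial_bound (a : R) (n p : nat) : R :=
  (2 * a) ^ n * INR (fact (4 * p)) / (a ^ p * INR (fact n) * INR (fact (3 * n))).

Lemma cut_monomial_bound_pos (a : R) (n p : nat) : 0 < a -> 0 < cut_monomial_bound a n p.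
Proof.
intros ha. apply Rdiv_lt_0_compat.
- apply Rmult_lt_0_compat; [apply pow_lt; lra|apply INR_fact_pos].
- repeat apply Rmult_lt_0_compat; try apply INR_fact_pos. apply pow_lt; lra.
Qed.

(** The factorials (4p-i)! / (n-i)! are traded for (4p)! 2^n / n!. *)
Lemma boundary_coef_bound (a : R) (n i q : nat) : 0 < a ->
  boundary_coef a n i * ((2 / (3 * a)) ^ q * INR (fact (3 * i + 4 + 4 * q))) <=
  cut_monomial_bound a n (S i + q) * (/ 3 * (2 / 3) ^ q).
Proof.
intros ha. unfold boundary_coef.
assert (pb := cut_monomial_bound_pos a n (S i + q) ha).
assert (p23 : 0 < (2 / 3) ^ q) by (apply pow_lt; lra).
destruct (Nat.leb_spec i n) as [hi|hi].
2:{ rewrite Rmult_0_l. apply Rmult_le_pos; lra. }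
assert (f1 := fact_mul_le i (3 * i + 4 + 4 * q)).
assert (f2 := fact_add_le i (n - i)).
replace (i + (3 * i + 4 + 4 * q))%nat with (4 * (S i + q))%nat in f1 by lia.
replace (i + (n - i))%nat with n in f2 by lia.
unfold cut_monomial_bound.
assert (q1 := INR_fact_pos i). assert (q2 := INR_fact_pos (3 * i + 4 + 4 * q)).
assert (q3 := INR_fact_pos n). assert (q4 := INR_fact_pos (n - i)).
assert (q5 := INR_fact_pos (4 * (S i + q))). assert (q6 := INR_fact_pos (3 * n)).
assert (r1 : 0 < a ^ i) by (apply pow_lt; lra).
assert (r2 : 0 < a ^ q) by (apply pow_lt; lra).
assert (r3 : 0 < a ^ (n - i)) by (apply pow_lt; lra).
assert (r4 : 0 < 2 ^ n) by (apply pow_lt; lra).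
set (F := INR (fact (3 * i + 4 + 4 * q))) in *. set (G := INR (fact (4 * (S i + q)))) in *.
assert (key : F / INR (fact (n - i)) <= 2 ^ n * G / INR (fact n)).
{ apply Rle_trans with (2 ^ n * (INR (fact i) * F) / INR (fact n)).
  - apply Rmult_le_reg_r with (INR (fact n)); [exact q3|].
    apply Rmult_le_reg_r with (INR (fact (n - i))); [exact q4|].
    field_simplify; try lra. nra.
  - apply Rmult_le_compat_r; [left; apply Rinv_0_lt_compat; lra|].
    apply Rmult_le_compat_l; lra. }
replace (2 / (3 * a)) with (2 / 3 * / a) by (field; lra).
rewrite (Rpow_mult_distr (2 / 3)), pow_inv.
replace (a ^ (n - i) / (3 * a * INR (fact (n - i)) * INR (fact (3 * n))) *
  ((2 / 3) ^ q * / a ^ q * F)) with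
  ((F / INR (fact (n - i))) * (a ^ (n - i) * (2 / 3) ^ q / (3 * a * INR (fact (3 * n)) * a ^ q)))
  by (field; repeat split; lra).
replace ((2 * a) ^ n * G / (a ^ (S i + q) * INR (fact n) * INR (fact (3 * n))) *
  (/ 3 * (2 / 3) ^ q)) with
  ((2 ^ n * G / INR (fact n)) * (a ^ (n - i) * (2 / 3) ^ q / (3 * a * INR (fact (3 * n)) * a ^ q))).
- apply Rmult_le_compat_r; [|exact key].
  apply Rmult_le_pos; [nra|left; apply Rinv_0_lt_compat].
  repeat apply Rmult_lt_0_compat; lra.
- rewrite Rpow_mult_distr. replace (a ^ n) with (a ^ (n - i) * a ^ i)
    by (rewrite <- pow_add; f_equal; lia).
  rewrite pow_add. simpl (a ^ S i). field. repeat split; lra.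
Qed.

Lemma boundary_coef_ge0 (a : R) (n i : nat) : 0 < a -> 0 <= boundary_coef a n i.
Proof.
intros ha. unfold boundary_coef. destruct (Nat.leb i n); [|lra].
left. apply Rdiv_lt_0_compat; [apply pow_lt, ha|].
repeat apply Rmult_lt_0_compat; try apply INR_fact_pos; lra.
Qed.

(** The newest endpoint term takes one third of the budget, the older ones, which have
    one derivative more, two thirds. *)
Lemma boundary_bound (a : R) (n p q : nat) (t : R) : 0 < a -> 0 < t ->
  Rabs (boundary a n p q t) <= cut_monomial_bound a n (p + q) * (2 / 3) ^ q.
Proof.
intros ha ht. revert q. induction p as [|p IH]; intros q; simpl boundary.
- rewrite Rabs_R0. apply Rmult_le_pos; [left; apply cut_monomial_bound_pos, ha|].
  apply pow_le; lra.
- eapply Rle_trans; [apply Rabs_triang|].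
  assert (h1 := IH (S q)). replace (p + S q)%nat with (S p + q)%nat in h1 by lia.
  assert (h2 : Rabs (boundary_coef a n p * flat a q (3 * p + 4) t) <=
    cut_monomial_bound a n (S p + q) * (/ 3 * (2 / 3) ^ q)).
  { rewrite Rabs_mult, (Rabs_pos_eq (boundary_coef a n p)) by (apply boundary_coef_ge0, ha).
    eapply Rle_trans; [|apply boundary_coef_bound, ha].
    apply Rmult_le_compat_l; [apply boundary_coef_ge0, ha|apply flat_bound; assumption]. }
  eapply Rle_trans; [apply Rplus_le_compat; [exact h1|exact h2]|].
  right. simpl pow. field.
Qed.

Lemma boundary_derive (a : R) (n p q : nat) (t : R) : 0 < a -> 0 < t ->
  is_derive (boundary a n p q) t (boundary a n p (S q) t).
Proof.
intros ha ht. revert q. induction p as [|p IH]; intros q.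
- simpl. apply (is_derive_const (K := R_AbsRing) (V := R_NormedModule)).
- change (boundary a n (S p) (S q) t) with
    (boundary a n p (S (S q)) t + boundary_coef a n p * flat a (S q) (3 * p + 4) t).
  apply (is_derive_plus (K := R_AbsRing) (V := R_NormedModule) (boundary a n p (S q))
    (fun t => boundary_coef a n p * flat a q (3 * p + 4) t)).
  + apply IH.
  + apply is_derive_scal, flat_derive; assumption.
Qed.

Lemma boundary_small (a : R) (n p q : nat) : 0 < a ->
  exists C, 0 <= C /\ forall t, 0 < t -> Rabs (boundary a n p q t) <= C * t.
Proof.
intros ha. revert q. induction p as [|p IH]; intros q.
- exists 0. split; [lra|]. intros t _. simpl. rewrite Rabs_R0. lra.
- destruct (IH (S q)) as [C [hC h]].
  destruct (flat_small a q (3 * p + 4) ha) as [C' [hC' h']].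
  assert (hk := boundary_coef_ge0 a n p ha).
  exists (C + boundary_coef a n p * C'). split; [nra|]. intros t ht. simpl boundary.
  eapply Rle_trans; [apply Rabs_triang|]. rewrite Rmult_plus_distr_r.
  apply Rplus_le_compat; [apply h, ht|].
  rewrite Rabs_mult, Rabs_pos_eq, Rmult_assoc by exact hk.
  apply Rmult_le_compat_l; [exact hk|apply h', ht].
Qed.

Definition cut_monomial (a : R) (n p : nat) (t : R) : R :=
  (if Nat.leb p n then t ^ (n - p) / INR (fact (n - p)) * exp_rem (3 * n) (zeta a t) else 0)
  - boundary a n p 0 t.

Lemma cut_monomial_derive (a : R) (n p : nat) (t : R) : 0 < a -> 0 < t ->
  is_derive (cut_monomial a n p) t (cut_monomial a n (S p) t).
Proof.
intros ha ht.
apply is_derive_eq with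
 (((if Nat.leb (S p) n then t ^ (n - S p) / INR (fact (n - S p)) * exp_rem (3 * n) (zeta a t) else 0)
  - boundary_coef a n p * flat a 0 (3 * p + 4) t) - boundary a n p 1 t).
2:{ unfold cut_monomial. change (boundary a n (S p) 0 t) with (boundary a n p 1 t + boundary_coef a n p * flat a 0 (3 * p + 4) t). ring. }
apply (is_derive_minus (K := R_AbsRing) (V := R_NormedModule)); [|apply boundary_derive; assumption].
unfold boundary_coef.
destruct (Nat.leb_spec p n) as [hp|hp].
2:{ destruct (Nat.leb_spec (S p) n) as [hp'|hp']; [lia|].
    replace (0 - 0 * flat a 0 (3 * p + 4) t) with 0 by ring.
    apply (is_derive_const (K := R_AbsRing) (V := R_NormedModule)). }
set (k := (n - p)%nat).
assert (D : is_derive (fun t => exp_rem (3 * n) (zeta a t)) t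
   (- zeta a t ^ 4 / (3 * a) * (zeta a t ^ (3 * n) * exp (- zeta a t) / INR (fact (3 * n))))).
{ apply (is_derive_comp (exp_rem (3 * n)) (zeta a)); [apply exp_rem_derive|].
  apply zeta_derive; assumption. }
assert (D' : is_derive (fun t => t ^ k / INR (fact k)) t
   (if Nat.leb (S p) n then t ^ (n - S p) / INR (fact (n - S p)) else 0)).
{ destruct (Nat.leb_spec (S p) n) as [hp'|hp'].
  - replace k with (S (n - S p)) by (unfold k; lia).
    assert (q := INR_fact_pos (n - S p)). assert (q' := pos_INR (n - S p)).
    assert (q2 := INR_fact_pos (S (n - S p))).
    apply is_derive_eq with ((INR (n - S p) + 1) * t ^ (n - S p) / INR (fact (S (n - S p)))).
    + apply is_derive_ext with (fun t => / INR (fact (S (n - S p))) * t ^ S (n - S p)).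
      { intros; unfold Rdiv; apply Rmult_comm. }
      apply is_derive_eq with (/ INR (fact (S (n - S p))) * ((INR (n - S p) + 1) * t ^ (n - S p)));
        [|unfold Rdiv; ring].
      apply is_derive_scal.
      apply is_derive_eq with (INR (S (n - S p)) * 1 * t ^ pred (S (n - S p))).
      * apply (is_derive_pow (fun x => x)). apply (is_derive_id (K := R_AbsRing)).
      * rewrite S_INR. simpl pred. ring.
    + rewrite INR_fact_S. field. split; lra.
  - replace k with 0%nat by (unfold k; lia). simpl.
    apply (is_derive_const (K := R_AbsRing) (V := R_NormedModule)). }
eapply is_derive_eq.
{ apply (is_derive_mult _ _ _ _ _ D' D). intros; apply Rmult_comm. }
change mult with Rmult. change plus with Rplus. cbv beta.
assert (E : t ^ k * zeta a t ^ (3 * k) = a ^ k).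
{ rewrite pow_mult, <- Rpow_mult_distr. f_equal. rewrite Rmult_comm. apply zeta_cube; assumption. }
assert (E2 : zeta a t ^ (3 * n) = zeta a t ^ (3 * k) * zeta a t ^ (3 * p)).
{ rewrite <- pow_add. f_equal. unfold k; lia. }
rewrite E2, <- E. fold k. simpl flat. rewrite (pow_add _ (3 * p) 4).
assert (q := INR_fact_pos k). assert (q' := INR_fact_pos (3 * n)).
destruct (Nat.leb (S p) n).
- assert (q2 := INR_fact_pos (n - S p)). simpl Nat.mul in *. field. repeat split; lra.
- simpl Nat.mul in *. field. repeat split; lra.
Qed.

(** In the integral term s^(3n) is at most z^(3(n-p)) s^(3p), with z = (a/t)^(1/3)
    and t z^3 = a; so no power of t remains. *)
Lemma cut_monomial_le (a : R) (n p : nat) (t : R) : 0 < a -> 0 < t ->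
  Rabs (cut_monomial a n p t) <= 2 * cut_monomial_bound a n p.
Proof.
intros ha ht. unfold cut_monomial.
eapply Rle_trans; [apply Rabs_triang|]. rewrite Rabs_Ropp.
assert (h1 := boundary_bound a n p 0 t ha ht). rewrite Nat.add_0_r in h1.
simpl pow in h1. rewrite Rmult_1_r in h1.
assert (pb := cut_monomial_bound_pos a n p ha).
assert (h2 : Rabs (if Nat.leb p n then t ^ (n - p) / INR (fact (n - p)) * exp_rem (3 * n) (zeta a t)
   else 0) <= cut_monomial_bound a n p); [|lra].
destruct (Nat.leb_spec p n) as [hp|hp]; [|rewrite Rabs_R0; lra].
set (k := (n - p)%nat).
assert (pz := zeta_pos a t).
assert (hz := exp_rem_add_le (3 * p) (3 * k) (zeta a t) ltac:(lra)).
replace (3 * p + 3 * k)%nat with (3 * n)%nat in hz by (unfold k; lia).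
assert (E : t ^ k * zeta a t ^ (3 * k) = a ^ k).
{ rewrite pow_mult, <- Rpow_mult_distr. f_equal. rewrite Rmult_comm. apply zeta_cube; assumption. }
assert (tk : 0 < t ^ k) by (apply pow_lt, ht).
assert (ak : 0 < a ^ k) by (apply pow_lt, ha).
assert (ap : 0 < a ^ p) by (apply pow_lt, ha).
assert (q1 := INR_fact_pos k). assert (q2 := INR_fact_pos (3 * n)).
assert (q3 := INR_fact_pos (3 * p)). assert (q4 := INR_fact_pos n).
assert (q5 := INR_fact_pos p). assert (q6 := INR_fact_pos (4 * p)).
assert (n2 : 0 < 2 ^ n) by (apply pow_lt; lra).
assert (f1 := fact_mul_le p (3 * p)). assert (f2 := fact_add_le p k).
replace (p + 3 * p)%nat with (4 * p)%nat in f1 by lia.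
replace (p + k)%nat with n in f2 by (unfold k; lia).
rewrite Rabs_pos_eq.
2:{ apply Rmult_le_pos; [left; apply Rdiv_lt_0_compat; lra|apply exp_rem_ge0; lra]. }
apply Rle_trans with (t ^ k / INR (fact k) * (zeta a t ^ (3 * k) * INR (fact (3 * p)) / INR (fact (3 * n)))).
{ apply Rmult_le_compat_l; [left; apply Rdiv_lt_0_compat; lra|].
  apply Rmult_le_reg_l with (INR (fact (3 * n))); [exact q2|].
  replace (INR (fact (3 * n)) * (zeta a t ^ (3 * k) * INR (fact (3 * p)) / INR (fact (3 * n)))) with
    (zeta a t ^ (3 * k) * INR (fact (3 * p))) by (field; lra). exact hz. }
replace (t ^ k / INR (fact k) * (zeta a t ^ (3 * k) * INR (fact (3 * p)) / INR (fact (3 * n)))) with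
  (a ^ k * INR (fact (3 * p)) / (INR (fact k) * INR (fact (3 * n)))).
2:{ rewrite <- E. field; split; lra. }
unfold cut_monomial_bound. rewrite Rpow_mult_distr.
replace (a ^ n) with (a ^ k * a ^ p) by (rewrite <- pow_add; f_equal; unfold k; lia).
replace (2 ^ n * (a ^ k * a ^ p) * INR (fact (4 * p)) / (a ^ p * INR (fact n) * INR (fact (3 * n))))
  with ((2 ^ n * INR (fact (4 * p)) / INR (fact n)) * (a ^ k / INR (fact (3 * n))))
  by (field; repeat split; lra).
replace (a ^ k * INR (fact (3 * p)) / (INR (fact k) * INR (fact (3 * n)))) with
  ((INR (fact (3 * p)) / INR (fact k)) * (a ^ k / INR (fact (3 * n)))) by (field; repeat split; lra).
apply Rmult_le_compat_r; [left; apply Rdiv_lt_0_compat; lra|].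
apply Rle_trans with (2 ^ n * (INR (fact p) * INR (fact (3 * p))) / INR (fact n)).
- apply Rmult_le_reg_r with (INR (fact n)); [exact q4|].
  apply Rmult_le_reg_r with (INR (fact k)); [exact q1|].
  field_simplify; try lra. nra.
- apply Rmult_le_compat_r; [left; apply Rinv_0_lt_compat; lra|].
  apply Rmult_le_compat_l; lra.
Qed.

(** 1 - [exp_rem] and the endpoint terms are flat at 0, so the jet at 0 is that of
    t^n/n!. *)
Lemma cut_monomial_small (a : R) (n p : nat) : 0 < a ->
  exists C, forall t, 0 < t < 1 ->
    Rabs (cut_monomial a n p t - (if Nat.eqb n p then 1 else 0)) <= C * t.
Proof.
intros ha. destruct (boundary_small a n p 0 ha) as [C [hC h]].
unfold cut_monomial.
destruct (Nat.eqb_spec n p) as [<-|ne].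
- destruct (exp_rem_small a (3 * n) ha) as [C' [hC' h']].
  exists (C' + C). intros t [ht _]. rewrite Nat.leb_refl, Nat.sub_diag.
  replace (t ^ 0 / INR (fact 0) * exp_rem (3 * n) (zeta a t) - boundary a n n 0 t - 1) with
    ((exp_rem (3 * n) (zeta a t) - 1) - boundary a n n 0 t) by (simpl; field).
  eapply Rle_trans; [apply Rabs_triang|]. rewrite Rabs_Ropp, Rmult_plus_distr_r.
  apply Rplus_le_compat; auto.
- destruct (Nat.leb_spec p n) as [hp|hp].
  + exists (1 + C). intros t [ht ht1]. rewrite Rminus_0_r.
    eapply Rle_trans; [apply Rabs_triang|]. rewrite Rabs_Ropp, Rmult_plus_distr_r.
    apply Rplus_le_compat; [|auto].
    assert (pz := zeta_pos a t).
    assert (g1 := exp_rem_ge0 (3 * n) (zeta a t) ltac:(lra)).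
    assert (g2 := exp_rem_le1 (3 * n) (zeta a t) ltac:(lra)).
    replace (n - p)%nat with (S (n - p - 1)) by lia. set (j := (n - p - 1)%nat).
    assert (f1 : 1 <= INR (fact (S j))) by (apply (le_INR 1), lt_O_fact).
    assert (f2 : 0 < / INR (fact (S j)) <= 1).
    { split; [apply Rinv_0_lt_compat; lra|]. rewrite <- Rinv_1. apply Rinv_le_contravar; lra. }
    assert (f3 : 0 < t ^ j <= 1).
    { split; [apply pow_lt, ht|]. rewrite <- (pow1 j). apply pow_incr; lra. }
    simpl pow. unfold Rdiv. rewrite Rabs_pos_eq.
    * replace (t * t ^ j * / INR (fact (S j)) * exp_rem (3 * n) (zeta a t)) with
        (t ^ j * (/ INR (fact (S j)) * exp_rem (3 * n) (zeta a t)) * t) by ring.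
      apply Rmult_le_compat_r; [lra|].
      rewrite <- (Rmult_1_l 1). apply Rmult_le_compat; [lra|nra|lra|].
      rewrite <- (Rmult_1_l 1). apply Rmult_le_compat; lra.
    * repeat apply Rmult_le_pos; lra.
  + exists C. intros t [ht _].
    replace (0 - boundary a n p 0 t - 0) with (- boundary a n p 0 t) by ring.
    rewrite Rabs_Ropp. auto.
Qed.

(** * Gevrey functions with prescribed jets at both ends *)

Lemma is_series_delta (D : nat -> R) (p : nat) :
  is_series (fun n => D n * (if Nat.eqb n p then 1 else 0)) (D p).
Proof.
assert (h : forall N, @eq R (sum_n (fun n => D n * (if Nat.eqb n p then 1 else 0)) N)
  (if Nat.leb p N then D p else 0)).
{ induction N as [|N IH].
  - rewrite sum_O. destruct p; simpl; ring.
  - rewrite sum_Sn, IH.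
    match goal with |- plus ?a ?b = ?c => change (@eq R (a + b) c) end.
    destruct (Nat.eqb_spec (S N) p) as [<-|ne].
    + rewrite Nat.leb_refl. destruct (Nat.leb_spec (S N) N); [lia|ring].
    + destruct (Nat.leb_spec p N); destruct (Nat.leb_spec p (S N)); try lia; ring. }
unfold is_series.
apply filterlim_ext_loc with (fun _ : nat => D p).
- exists p. intros N hN. rewrite h. destruct (Nat.leb_spec p N); [reflexivity|lia].
- apply filterlim_const.
Qed.

Lemma fact_4n_3 (n : nat) :
  INR (fact (4 * n + 3)) <= 384 * 64 ^ n * (INR (fact n) * INR (fact (3 * n))).
Proof.
replace (4 * n + 3)%nat with (S (S (S (n + 3 * n)))) by lia.
rewrite !INR_fact_S, !S_INR.
replace (INR (n + 3 * n)) with (4 * INR n) by (rewrite plus_INR, mult_INR; simpl; ring).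
assert (h := fact_add_le n (3 * n)).
replace (2 ^ (n + 3 * n)) with (16 ^ n) in h.
2:{ replace (n + 3 * n)%nat with (4 * n)%nat by lia. rewrite pow_mult. f_equal; ring. }
assert (c : (INR n + 1) * (INR n + 2) * (INR n + 3) <= 6 * 4 ^ n).
{ clear h. induction n as [|n IH]; [simpl; lra|]. rewrite S_INR. simpl pow.
  assert (p := pos_INR n).
  apply Rle_trans with (4 * ((INR n + 1) * (INR n + 2) * (INR n + 3))); [|lra].
  replace ((INR n + 1 + 1) * (INR n + 1 + 2) * (INR n + 1 + 3)) with
    (((INR n + 2) * (INR n + 3)) * (INR n + 4)) by ring.
  replace (4 * ((INR n + 1) * (INR n + 2) * (INR n + 3))) with
    (((INR n + 2) * (INR n + 3)) * (4 * (INR n + 1))) by ring.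
  apply Rmult_le_compat_l; [apply Rmult_le_pos; lra|lra]. }
assert (p := pos_INR n).
assert (q1 := INR_fact_pos n). assert (q2 := INR_fact_pos (3 * n)).
assert (q3 := INR_fact_pos (n + 3 * n)).
replace (64 ^ n) with (4 ^ n * 16 ^ n) by (rewrite <- Rpow_mult_distr; f_equal; ring).
replace (384 * (4 ^ n * 16 ^ n) * (INR (fact n) * INR (fact (3 * n)))) with
  ((64 * (6 * 4 ^ n)) * (16 ^ n * (INR (fact n) * INR (fact (3 * n))))) by ring.
replace ((4 * INR n + 1 + 1 + 1) * ((4 * INR n + 1 + 1) * ((4 * INR n + 1) * INR (fact (n + 3 * n)))))
  with (((4 * INR n + 1) * (4 * INR n + 2) * (4 * INR n + 3)) * INR (fact (n + 3 * n))) by ring.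
apply Rmult_le_compat; [repeat apply Rmult_le_pos; lra|lra| |exact h].
apply Rle_trans with (64 * ((INR n + 1) * (INR n + 2) * (INR n + 3))); [|lra].
replace (64 * ((INR n + 1) * (INR n + 2) * (INR n + 3))) with
  ((4 * (INR n + 1)) * (4 * (INR n + 2)) * (4 * (INR n + 3))) by ring.
repeat apply Rmult_le_compat; try apply Rmult_le_pos; lra.
Qed.

Lemma ex_series_geom_scal (c q : R) : 0 <= q < 1 -> ex_series (fun n => c * q ^ n).
Proof.
intros h. apply ex_series_mult_l, ex_series_geom. rewrite Rabs_pos_eq; lra.
Qed.

Lemma Series_geom_scal (c q : R) : 0 <= q < 1 -> Series (fun n => c * q ^ n) = c / (1 - q).
Proof.
intros h. rewrite Series_scal_l, Series_geom by (rewrite Rabs_pos_eq; lra). reflexivity.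
Qed.

(** Borel's theorem with Gevrey bounds: the monomials of the Taylor series are replaced
    by their truncations, with a = 12, and the series of ratio 64 * 24 / 2048 = 3/4
    converges with all derivatives. *)
Lemma borel_at_0 (M : R) (D : nat -> R) : 0 <= M ->
  (forall n, Rabs (D n) <= M * INR (fact (4 * n + 3)) / 2048 ^ n) ->
  exists G : nat -> R -> R,
    (forall b, jets_on 0 b G) /\
    (forall p t, 0 <= t -> Rabs (G p t) <= 3072 * M * INR (fact (4 * p)) / 12 ^ p) /\
    (forall p, G p 0 = D p).
Proof.
intros hM hD.
set (l := fun n p => if Nat.eqb n p then 1 else 0).
set (u := fun n p => extend0 (l n p) (cut_monomial 12 n p)).
assert (hu := fun n => extend0_jets (cut_monomial 12 n) (l n) (fun p => 2 * cut_monomial_bound 12 n p)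
  (fun p t ht => cut_monomial_derive 12 n p t ltac:(lra) ht)
  (fun p t ht => cut_monomial_le 12 n p t ltac:(lra) ht)
  (fun p => cut_monomial_small 12 n p ltac:(lra))).
set (v := fun p => 768 * M * INR (fact (4 * p)) / 12 ^ p).
assert (hv : forall p, 0 <= v p).
{ intros p. unfold v. apply Rmult_le_pos.
  - apply Rmult_le_pos; [lra|left; apply INR_fact_pos].
  - left; apply Rinv_0_lt_compat, pow_lt; lra. }
assert (hDu : forall n p, Rabs (D n) * (2 * cut_monomial_bound 12 n p) <= v p * (3 / 4) ^ n).
{ intros n p.
  assert (pb := cut_monomial_bound_pos 12 n p ltac:(lra)).
  eapply Rle_trans; [apply Rmult_le_compat_r; [lra|apply hD]|].
  assert (p1 : 0 < 2048 ^ n) by (apply pow_lt; lra).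
  assert (p2 : 0 < 12 ^ p) by (apply pow_lt; lra).
  assert (q1 := INR_fact_pos n). assert (q2 := INR_fact_pos (3 * n)).
  assert (q3 := INR_fact_pos (4 * p)).
  unfold cut_monomial_bound, v.
  replace (M * INR (fact (4 * n + 3)) / 2048 ^ n *
    (2 * ((2 * 12) ^ n * INR (fact (4 * p)) / (12 ^ p * INR (fact n) * INR (fact (3 * n))))))
    with ((2 * M * INR (fact (4 * p)) / 12 ^ p) *
      (INR (fact (4 * n + 3)) * ((2 * 12) ^ n / (2048 ^ n * INR (fact n) * INR (fact (3 * n))))))
    by (field; repeat split; lra).
  replace (768 * M * INR (fact (4 * p)) / 12 ^ p * (3 / 4) ^ n) with
    ((2 * M * INR (fact (4 * p)) / 12 ^ p) * (384 * 64 ^ n * (INR (fact n) * INR (fact (3 * n))) *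
       ((2 * 12) ^ n / (2048 ^ n * INR (fact n) * INR (fact (3 * n)))))).
  - apply Rmult_le_compat_l.
    + apply Rmult_le_pos; [nra|left; apply Rinv_0_lt_compat; lra].
    + apply Rmult_le_compat_r; [|apply fact_4n_3].
      left; apply Rdiv_lt_0_compat; [apply pow_lt; lra|].
      repeat apply Rmult_lt_0_compat; lra.
  - replace ((3 / 4) ^ n) with (64 ^ n * (2 * 12) ^ n * / 2048 ^ n)
      by (rewrite <- pow_inv, <- !Rpow_mult_distr; f_equal; field).
    field. repeat split; lra. }
assert (ev : forall p, ex_series (fun n => v p * (3 / 4) ^ n))
  by (intros; apply ex_series_geom_scal; lra).
assert (hbd : forall p n t, 0 <= t -> Rabs (D n * u n p t) <= v p * (3 / 4) ^ n).
{ intros p n t ht. eapply Rle_trans; [|apply hDu]. rewrite Rabs_mult.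
  apply Rmult_le_compat_l; [apply Rabs_pos|]. apply (proj1 (hu n)), ht. }
exists (fun p t => Series (fun n => D n * u n p t)). split; [|split].
- intros b p. exists (Series (fun n => v (S (S p)) * (3 / 4) ^ n)).
  apply taylor_on_series with (v := fun n => v p * (3 / 4) ^ n)
     (w := fun n => v (S p) * (3 / 4) ^ n); auto.
  + intros k t ht. apply hbd; lra.
  + intros k t ht. apply hbd; lra.
  + intros k s t hs ht.
    replace (D k * u k p s - D k * u k p t - (s - t) * (D k * u k (S p) t)) with
      (D k * (u k p s - u k p t - (s - t) * u k (S p) t)) by ring.
    rewrite Rabs_mult.
    eapply Rle_trans; [apply Rmult_le_compat_l; [apply Rabs_pos|apply (proj2 (hu k) p b s t hs ht)]|].
    rewrite <- Rmult_assoc. apply Rmult_le_compat_r; [apply pow2_ge_0|apply hDu].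
- intros p t ht.
  destruct (Series_bound (fun n => D n * u n p t) _ (fun n => hbd p n t ht) (ev p)) as [_ h].
  eapply Rle_trans; [exact h|]. rewrite Series_geom_scal by lra. right. unfold v. field.
  apply pow_nonzero; lra.
- intros p. rewrite (Series_ext _ (fun n => D n * (if Nat.eqb n p then 1 else 0))).
  + apply is_series_unique, is_series_delta.
  + intros n. unfold u. rewrite extend0_0. reflexivity.
Qed.

Lemma lipschitz_continuous (f : R -> R) (L x : R) :
  (forall s t, Rabs (f s - f t) <= L * Rabs (s - t)) -> continuous f x.
Proof.
intros h. apply continuity_pt_filterlim. intros eps he.
assert (hL : 0 < Rabs L + 1) by (assert (q := Rabs_pos L); lra).
exists (eps / (Rabs L + 1)). split; [apply Rdiv_lt_0_compat; lra|].
intros y [_ hy]. simpl in *. unfold R_dist in *.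
eapply Rle_lt_trans; [apply h|].
apply Rle_lt_trans with ((Rabs L + 1) * Rabs (y - x)).
- apply Rmult_le_compat_r; [apply Rabs_pos|]. assert (q := Rle_abs L); lra.
- apply Rmult_lt_compat_l with (r := Rabs L + 1) in hy; [|exact hL].
  replace ((Rabs L + 1) * (eps / (Rabs L + 1))) with eps in hy by (field; lra). exact hy.
Qed.

(** Extends functions on [0,T] by constants, to integrate and differentiate them on R. *)
Definition clamp (T t : R) : R := Rmax 0 (Rmin T t).

Lemma clamp_in (T t : R) : 0 <= T -> 0 <= clamp T t <= T.
Proof.
intros h. unfold clamp. split; [apply Rmax_l|]. apply Rmax_lub; [lra|apply Rmin_l].
Qed.

Lemma clamp_id (T t : R) : 0 <= t <= T -> clamp T t = t.
Proof. intros h. unfold clamp. rewrite Rmin_right, Rmax_right; lra. Qed.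

Lemma clamp_lipschitz (T s t : R) : Rabs (clamp T s - clamp T t) <= Rabs (s - t).
Proof.
unfold clamp, Rmax, Rmin.
repeat destruct Rle_dec; unfold Rabs; repeat destruct Rcase_abs; lra.
Qed.

Lemma jets_primitive (T : R) (B : nat -> R -> R) : 0 <= T -> jets_on 0 T B ->
  unif_deriv 0 T (fun t => RInt (fun u => B 0%nat (clamp T u)) 0 t) (B 0%nat) /\
  forall x, continuous (fun u => B 0%nat (clamp T u)) x.
Proof.
intros hT hB. set (f := fun u => B 0%nat (clamp T u)).
destruct (unif_deriv_bounded 0 T _ _ hT (hB 1%nat)) as [L [hL bL]].
assert (lip := unif_deriv_lipschitz 0 T L _ _ (hB 0%nat) bL).
assert (lipf : forall s t, Rabs (f s - f t) <= L * Rabs (s - t)).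
{ intros s t. unfold f. eapply Rle_trans; [apply lip; apply clamp_in, hT|].
  apply Rmult_le_compat_l; [exact hL|apply clamp_lipschitz]. }
assert (cf : forall x, continuous f x) by (intros x; apply lipschitz_continuous with L, lipf).
split; [|exact cf].
assert (hd : forall x, is_derive (fun t => RInt f 0 t) x (f x)).
{ intros x. apply (is_derive_RInt (V := R_NormedModule) f (fun t => RInt f 0 t) 0 x); [|apply cf].
  apply filter_forall. intros b. apply (RInt_correct (V := R_CompleteNormedModule)).
  apply (ex_RInt_continuous (V := R_CompleteNormedModule)). intros; apply cf. }
exists L. intros s t hs ht.
destruct (MVT_is_derive (fun t => RInt f 0 t) f s t) as [c [hc E]].
- intros; apply hd.
- rewrite E. replace (f c * (s - t) - (s - t) * B 0%nat t) with ((f c - B 0%nat t) * (s - t)) by ring.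
  rewrite Rabs_mult, <- pow2_abs. simpl pow. rewrite Rmult_1_r, <- Rmult_assoc.
  apply Rmult_le_compat_r; [apply Rabs_pos|].
  replace (B 0%nat t) with (f t) by (unfold f; rewrite clamp_id by assumption; reflexivity).
  eapply Rle_trans; [apply lipf|]. apply Rmult_le_compat_l; [exact hL|].
  apply between_dist, hc.
Qed.

(** The product of a flat function and its reflection. *)
Lemma bump_exists (T : R) : 0 < T ->
  exists B : nat -> R -> R, jets_on 0 T B /\
    (forall p t, 0 <= t <= T -> Rabs (B p t) <= INR (fact (4 * p)) / 12 ^ p) /\
    (forall p, B p 0 = 0 /\ B p T = 0) /\ (forall t, 0 < t < T -> 0 < B 0%nat t).
Proof.
intros hT.
(* a = 16 gives the radius 3a/2 = 24, and the product loses a factor 2. *)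
destruct (extend0_jets (fun q => flat 16 q 0) (fun _ => 0)
  (fun q => (2 / (3 * 16)) ^ q * INR (fact (0 + 4 * q)))) as [hb hj].
{ intros n t ht. apply flat_derive; lra. }
{ intros n t ht. apply flat_bound; lra. }
{ intros n. destruct (flat_small 16 n 0 ltac:(lra)) as [C [_ h]].
  exists C. intros t [ht _]. rewrite Rminus_0_r. apply h, ht. }
set (e := fun q => extend0 0 (flat 16 q 0)) in *.
assert (je : jets_on 0 T e) by (intros n; eexists; apply hj).
assert (be : forall q t, 0 <= t -> Rabs (e q t) <= 1 * INR (fact (0 + 4 * q)) / 24 ^ q).
{ intros q t ht. eapply Rle_trans; [apply hb, ht|]. right.
  replace (2 / (3 * 16)) with (/ 24) by field. rewrite pow_inv. unfold Rdiv. ring. }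
assert (e0 : forall q, e q 0 = 0) by (intros; apply extend0_0).
assert (ep : forall t, 0 < t -> 0 < e 0%nat t).
{ intros t ht. unfold e. rewrite extend0_pos by exact ht. simpl. rewrite Rmult_1_l. apply exp_pos. }
exists (fun p t => leibniz (fun i => e i t) (fun i => (-1) ^ i * e i (T - t)) p).
split; [|split; [|split]].
- apply jets_on_leibniz; [lra|exact je|apply jets_on_reflect, je].
- intros p t ht.
  eapply Rle_trans.
  { apply (leibniz_bound 0 24 24 12 ltac:(lra) ltac:(lra) ltac:(lra)) with
      (k := 0%nat) (m := 0%nat) (cF := 1) (cG := 1).
    - intros k m _ _. apply rise4_radii; lra.
    - lia.
    - lia.
    - lra.
    - lra.
    - intros i _. apply be; lra.
    - intros i _. rewrite Rabs_mult, pow_1_abs, Rmult_1_l. apply be; lra. }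
  right. change (fact (0 + 0)) with 1%nat. change (fact 0) with 1%nat.
  change (0 + 0 + 4 * p)%nat with (4 * p)%nat. simpl (INR 1). field. apply pow_nonzero; lra.
- intros p. split; [apply leibniz_0_l|apply leibniz_0_r]; intros i _; [apply e0|].
  replace (T - T) with 0 by ring. rewrite e0; ring.
- intros t ht. simpl. rewrite Rmult_1_l. apply Rmult_lt_0_compat; apply ep; lra.
Qed.

(** The normalized primitive of a bump, reflected: its derivatives are those of the
    bump, shifted by one. *)
Lemma cutoff_exists (T : R) : 0 < T ->
  exists (chi : nat -> R -> R) (K : R), 0 < K /\ jets_on 0 T chi /\
    (forall p t, 0 <= t <= T -> Rabs (chi p t) <= K * INR (fact (4 * p)) / 12 ^ p) /\
    chi 0%nat 0 = 1 /\ (forall p, chi (S p) 0 = 0) /\ (forall p, chi p T = 0).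
Proof.
intros hT.
destruct (bump_exists T hT) as [B [jB [bB [zB pB]]]].
destruct (jets_primitive T B ltac:(lra) jB) as [hP cB].
set (P := fun t => RInt (fun u => B 0%nat (clamp T u)) 0 t : R) in *.
assert (hI : 0 < P T).
{ apply RInt_gt_0; [exact hT| |intros; apply cB].
  intros x hx. rewrite clamp_id by lra. apply pB, hx. }
assert (hi : 0 < / P T) by (apply Rinv_0_lt_compat; exact hI).
set (s := fun p t => / P T * match p with O => P t | S p => B p t end).
assert (js : jets_on 0 T s).
{ intros [|p]; unfold s; [apply (unif_deriv_scal 0 T (/ P T) P (B 0%nat)), hP|].
  apply (unif_deriv_scal 0 T (/ P T) (B p) (B (S p))), jB. }
destruct (unif_deriv_bounded 0 T _ _ ltac:(lra) hP) as [K0 [hK0 bK0]].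
exists (fun p t => (-1) ^ p * s p (T - t)), (/ P T * (K0 + 12)).
assert (P0 : P 0 = 0) by exact (RInt_point (V := R_CompleteNormedModule) 0 (fun u => B 0%nat (clamp T u))).
split; [apply Rmult_lt_0_compat; lra|]. split; [apply jets_on_reflect, js|].
split; [|split; [|split]].
- intros p t ht. rewrite Rabs_mult, pow_1_abs, Rmult_1_l. unfold s.
  rewrite Rabs_mult, (Rabs_pos_eq (/ P T)) by lra.
  unfold Rdiv. rewrite !Rmult_assoc. apply Rmult_le_compat_l; [lra|].
  destruct p as [|p].
  + simpl. rewrite Rinv_1, !Rmult_1_r. assert (q := bK0 (T - t) ltac:(lra)). lra.
  + eapply Rle_trans; [apply bB; lra|].
    assert (p12 : 0 < 12 ^ p) by (apply pow_lt; lra).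
    assert (f := fact_mul_le 4 (4 * p)). replace (4 + 4 * p)%nat with (4 * S p)%nat in f by lia.
    assert (q := INR_fact_pos (4 * p)).
    assert (f4 : 1 <= INR (fact 4)) by (apply (le_INR 1), lt_O_fact).
    simpl (12 ^ S p). rewrite Rinv_mult.
    replace ((K0 + 12) * (INR (fact (4 * S p)) * (/ 12 * / 12 ^ p))) with
      (((K0 + 12) / 12) * INR (fact (4 * S p)) * / 12 ^ p) by (field; lra).
    apply Rmult_le_compat_r; [left; apply Rinv_0_lt_compat; lra|].
    apply Rle_trans with (1 * INR (fact (4 * S p))).
    * rewrite Rmult_1_l. eapply Rle_trans; [|exact f].
      rewrite <- (Rmult_1_l (INR (fact (4 * p)))) at 1. apply Rmult_le_compat_r; lra.
    * apply Rmult_le_compat_r; [left; apply INR_fact_pos|lra].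
- simpl. unfold s. rewrite Rminus_0_r. field. lra.
- intros p. unfold s. rewrite Rminus_0_r, (proj2 (zB p)). ring.
- intros p. unfold s. replace (T - T) with 0 by ring.
  destruct p as [|p]; [rewrite P0; ring|rewrite (proj1 (zB p)); ring].
Qed.

Lemma borel_localized (T : R) : 0 < T ->
  exists K, 0 < K /\ forall (M : R) (D : nat -> R), 0 <= M ->
  (forall n, Rabs (D n) <= M * INR (fact (4 * n + 3)) / 2048 ^ n) ->
  exists G : nat -> R -> R, jets_on 0 T G /\
    (forall p t, 0 <= t <= T -> Rabs (G p t) <= K * M * INR (fact (4 * p)) / 6 ^ p) /\
    (forall p, G p 0 = D p) /\ (forall p, G p T = 0).
Proof.
intros hT. destruct (cutoff_exists T hT) as [chi [K [hK [jc [bc [c0 [c1 cT]]]]]]].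
exists (K * 3072). split; [lra|]. intros M D hM hD.
destruct (borel_at_0 M D hM hD) as [G [jG [bG G0]]].
exists (fun p t => leibniz (fun i => chi i t) (fun i => G i t) p).
split; [apply jets_on_leibniz; [lra|exact jc|apply jG]|]. split; [|split].
- intros p t ht. eapply Rle_trans.
  { apply (leibniz_bound 0 12 12 6 ltac:(lra) ltac:(lra) ltac:(lra)) with
      (k := 0%nat) (m := 0%nat) (cF := K) (cG := 3072 * M).
    - intros k m _ _. apply rise4_radii; lra.
    - lia.
    - lia.
    - lra.
    - lra.
    - intros i _. apply bc, ht.
    - intros i _. apply bG; lra. }
  right. change (fact (0 + 0)) with 1%nat. change (fact 0) with 1%nat.
  change (0 + 0 + 4 * p)%nat with (4 * p)%nat. simpl (INR 1). field. apply pow_nonzero; lra.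
- intros p. rewrite leibniz_1_l; auto.
- intros p. apply leibniz_0_l; intros; apply cT.
Qed.

Lemma borel_two_point (T : R) : 0 < T ->
  exists K, 0 < K /\ forall (M : R) (D D' : nat -> R), 0 <= M ->
  (forall n, Rabs (D n) <= M * INR (fact (4 * n + 3)) / 2048 ^ n) ->
  (forall n, Rabs (D' n) <= M * INR (fact (4 * n + 3)) / 2048 ^ n) ->
  exists G : nat -> R -> R, jets_on 0 T G /\
    (forall p t, 0 <= t <= T -> Rabs (G p t) <= K * M * INR (fact (4 * p)) / 6 ^ p) /\
    (forall p, G p 0 = D p) /\ (forall p, G p T = D' p).
Proof.
intros hT. destruct (borel_localized T hT) as [K [hK h]].
exists (2 * K). split; [lra|]. intros M D D' hM hD hD'.
destruct (h M D hM hD) as [G1 [j1 [b1 [z1 t1]]]].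
destruct (h M (fun p => (-1) ^ p * D' p) hM) as [G2 [j2 [b2 [z2 t2]]]].
{ intros n. rewrite Rabs_mult, pow_1_abs, Rmult_1_l. apply hD'. }
exists (fun p t => G1 p t + (-1) ^ p * G2 p (T - t)).
split; [apply jets_on_plus; [exact j1|apply jets_on_reflect, j2]|]. split; [|split].
- intros p t ht. eapply Rle_trans; [apply Rabs_triang|].
  rewrite Rabs_mult, pow_1_abs, Rmult_1_l.
  assert (q1 := b1 p t ht). assert (q2 := b2 p (T - t) ltac:(lra)).
  replace (2 * K * M * INR (fact (4 * p)) / 6 ^ p) with
    (K * M * INR (fact (4 * p)) / 6 ^ p + K * M * INR (fact (4 * p)) / 6 ^ p)
    by (field; apply pow_nonzero; lra). lra.
- intros p. rewrite Rminus_0_r, z1, t2. ring.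
- intros p. replace (T - T) with 0 by ring. rewrite t1, z2, <- Rmult_assoc, <- Rpow_mult_distr.
  replace (-1 * -1) with 1 by ring. rewrite pow1. ring.
Qed.

(** * Convergence of the power series in space *)

Lemma lateral_jets (T : R) (g1 g3 : nat -> R -> R) : 0 <= T ->
  jets_on 0 T g1 -> jets_on 0 T g3 -> forall k, jets_on 0 T (lateral g1 g3 k).
Proof.
intros hT h1 h3 k.
induction k as [k IH] using lt_wf_ind.
destruct (le_lt_dec 4 k) as [hk|hk].
2:{ destruct k as [|[|[|[|k]]]]; [| | | |lia].
    - intros n. apply (unif_deriv_const 0 T 0).
    - exact h1.
    - intros n. apply (unif_deriv_const 0 T 0).
    - exact h3. }
replace k with (k - 4 + 4)%nat by lia.
assert (IH' : forall j, (j <= k - 4 + 3)%nat -> jets_on 0 T (lateral g1 g3 j))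
  by (intros; apply IH; lia).
revert IH'. generalize (k - 4)%nat. clear k hk IH. intros m IH n.
set (b := lateral g1 g3) in *.
assert (hlow : unif_deriv 0 T (fun t => ks_lower (fun j i => b j i t) m n)
  (fun t => ks_lower (fun j i => b j i t) m (S n))).
{ unfold ks_lower.
  apply (unif_deriv_plus 0 T (fun t => (INR m + 1) * (INR m + 2) * b (m + 2)%nat n t)
     (fun t => (INR m + 1) * (INR m + 2) * b (m + 2)%nat (S n) t)).
  - apply unif_deriv_scal, IH; lia.
  - apply (unif_deriv_sum 0 T m
      (fun j t => INR (S (m - j)) * leibniz (fun i => b j i t) (fun i => b (S (m - j)) i t) n)
      (fun j t => INR (S (m - j)) * leibniz (fun i => b j i t) (fun i => b (S (m - j)) i t) (S n))).
    intros j hj. apply unif_deriv_scal.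
    apply (jets_on_leibniz 0 T (b j) (b (S (m - j)))); [exact hT|apply IH; lia|apply IH; lia]. }
apply unif_deriv_ext with
  (fun t => - / rise4 m * (b m (S n) t + ks_lower (fun j i => b j i t) m n))
  (fun t => - / rise4 m * (b m (S (S n)) t + ks_lower (fun j i => b j i t) m (S n))).
- intros t _. unfold b. rewrite lateral_succ4. unfold Rdiv. ring.
- intros t _. unfold b. rewrite lateral_succ4. unfold Rdiv. ring.
- apply unif_deriv_scal.
  apply (unif_deriv_plus 0 T (b m (S n)) (b m (S (S n)))); [apply IH; lia|exact hlow].
Qed.

(** A = 4/3 and B = 6 satisfy the condition of [ks_bound_x] with M = 1:
    2/9 + 1/16 + 1/12 < 27/64. *)
Lemma lateral_bound (g1 g3 : nat -> R -> R) (t : R) :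
  (forall n, Rabs (g1 n t) <= 27 / 64 * INR (fact (4 * n)) / 6 ^ n) ->
  (forall n, Rabs (g3 n t) <= 27 / 64 * INR (fact (4 * n)) / 6 ^ n) ->
  forall k n, Rabs (lateral g1 g3 k n t) <= weight (4 / 3) 6 1 k n.
Proof.
intros h1 h3.
apply (ks_bound_x (4 / 3) 6 1 (fun k n => lateral g1 g3 k n t)); try lra.
- apply lateral_ks.
- reflexivity.
- assert (w0 : forall k n, 0 <= weight (4 / 3) 6 1 k n).
  { intros k n. unfold weight. left. apply Rdiv_lt_0_compat.
    - assert (p := INR_fact_pos (k + 4 * n)). lra.
    - repeat apply Rmult_lt_0_compat; try apply INR_fact_pos; apply pow_lt; lra. }
  intros k n hk.
  assert (p6 : 0 < 6 ^ n) by (apply pow_lt; lra).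
  assert (i6 : 0 < / 6 ^ n) by (apply Rinv_0_lt_compat, p6).
  assert (pf := INR_fact_pos (4 * n)).
  destruct k as [|[|[|[|k]]]]; [| | | |lia].
  + change (Rabs 0 <= weight (4 / 3) 6 1 0 n). rewrite Rabs_R0. apply w0.
  + eapply Rle_trans; [apply h1|]. unfold weight.
    assert (f := fact_mul_le 1 (4 * n)). change (fact 1) with 1%nat in *. simpl (INR 1) in *.
    replace (1 * INR (fact (1 + 4 * n)) / (1 * (4 / 3) ^ 1 * 6 ^ n)) with
      (3 / 4 * INR (fact (1 + 4 * n)) / 6 ^ n) by (field; lra).
    unfold Rdiv at 1 3. apply Rmult_le_compat_r; lra.
  + change (Rabs 0 <= weight (4 / 3) 6 1 2 n). rewrite Rabs_R0. apply w0.
  + eapply Rle_trans; [apply h3|]. unfold weight.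
    assert (f := fact_mul_le 3 (4 * n)). change (fact 3) with 6%nat in *.
    replace (INR 6) with 6 in * by (simpl; ring).
    replace (1 * INR (fact (3 + 4 * n)) / (6 * (4 / 3) ^ 3 * 6 ^ n)) with
      (27 / 64 * (INR (fact (3 + 4 * n)) / 6) / 6 ^ n) by (field; lra).
    unfold Rdiv at 1 3. apply Rmult_le_compat_r; lra.
Qed.

Lemma CV_radius_gt_1 (a : nat -> R) (C x : R) :
  (forall k, Rabs (a k) <= C * (6 / 7) ^ k) -> Rabs x <= 1 ->
  Rbar_lt (Rabs x) (CV_radius a).
Proof.
intros h hx. apply Rbar_lt_le_trans with (7 / 6); [simpl; lra|].
apply (proj1 (CV_radius_bounded a)). exists C. intros n.
rewrite Rabs_mult, <- RPow_abs, (Rabs_pos_eq (7 / 6)) by lra.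
eapply Rle_trans; [apply Rmult_le_compat_r; [apply pow_le; lra|apply h]|].
rewrite Rmult_assoc, <- Rpow_mult_distr.
replace (6 / 7 * (7 / 6)) with 1 by field. rewrite pow1. lra.
Qed.

(** The coefficients of the p-th space derivative of the n-th time derivative. *)
Definition dx_coef (b : nat -> nat -> R -> R) (p n : nat) (t : R) (k : nat) : R :=
  INR (fact (k + p)) / INR (fact k) * b (k + p)%nat n t.

Definition coef_bound (p n : nat) : R :=
  INR (fact (p + 4 * n)) * 8 ^ (p + 4 * n) * (3 / 4) ^ p / 6 ^ n.

Lemma coef_bound_pos (p n : nat) : 0 < coef_bound p n.
Proof.
unfold coef_bound. apply Rdiv_lt_0_compat; [|apply pow_lt; lra].
repeat apply Rmult_lt_0_compat; try apply INR_fact_pos; apply pow_lt; lra.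
Qed.

(** Splitting 1 = 7/8 + 1/8 in [fact_prod_weighted]: the ratio 3/4 of the series
    becomes 6/7, and the derivatives cost powers of 8. *)
Lemma dx_weight (p n k : nat) :
  INR (fact (k + p)) / INR (fact k) * weight (4 / 3) 6 1 (k + p) n <= coef_bound p n * (6 / 7) ^ k.
Proof.
unfold weight, coef_bound.
assert (h := fact_prod_weighted (7 / 8) (1 / 8) k (p + 4 * n) ltac:(lra) ltac:(lra) ltac:(lra)).
replace (k + p + 4 * n)%nat with (k + (p + 4 * n))%nat by lia.
set (q := (p + 4 * n)%nat) in *.
assert (f1 := INR_fact_pos k). assert (f2 := INR_fact_pos (k + p)).
assert (p6 : 0 < 6 ^ n) by (apply pow_lt; lra).
assert (p78 : 0 < (7 / 8) ^ k) by (apply pow_lt; lra).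
assert (p34 : 0 < (3 / 4) ^ p) by (apply pow_lt; lra).
assert (p34k : 0 < (3 / 4) ^ k) by (apply pow_lt; lra).
assert (p8 : 0 < 8 ^ q) by (apply pow_lt; lra).
replace (4 / 3) with (/ (3 / 4)) by field.
rewrite pow_add, !pow_inv.
replace (1 / 8) with (/ 8) in h by field. rewrite pow_inv in h.
replace (6 / 7) with ((3 / 4) * / (7 / 8)) by field. rewrite Rpow_mult_distr, pow_inv.
replace (INR (fact (k + p)) / INR (fact k) * (1 * INR (fact (k + q)) /
  (INR (fact (k + p)) * (/ (3 / 4) ^ k * / (3 / 4) ^ p) * 6 ^ n))) with
  ((INR (fact (k + q)) * (7 / 8) ^ k * / 8 ^ q) * (8 ^ q * (3 / 4) ^ k * (3 / 4) ^ p /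
    ((7 / 8) ^ k * INR (fact k) * 6 ^ n))) by (field; repeat split; lra).
replace (INR (fact q) * 8 ^ q * (3 / 4) ^ p / 6 ^ n * ((3 / 4) ^ k * / (7 / 8) ^ k)) with
  ((INR (fact k) * INR (fact q)) * (8 ^ q * (3 / 4) ^ k * (3 / 4) ^ p /
    ((7 / 8) ^ k * INR (fact k) * 6 ^ n))) by (field; repeat split; lra).
apply Rmult_le_compat_r; [|exact h].
left. apply Rdiv_lt_0_compat; repeat apply Rmult_lt_0_compat; assumption.
Qed.

Lemma dx_coef_bound (b : nat -> nat -> R -> R) (p n k : nat) (t : R) :
  (forall k n, Rabs (b k n t) <= weight (4 / 3) 6 1 k n) ->
  Rabs (dx_coef b p n t k) <= coef_bound p n * (6 / 7) ^ k.
Proof.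
intros h. eapply Rle_trans; [|apply dx_weight]. unfold dx_coef.
assert (q : 0 < INR (fact (k + p)) / INR (fact k))
  by (apply Rdiv_lt_0_compat; apply INR_fact_pos).
rewrite Rabs_mult, Rabs_pos_eq by lra. apply Rmult_le_compat_l; [lra|apply h].
Qed.

Definition dxdt (b : nat -> nat -> R -> R) (p n : nat) (x t : R) : R :=
  PSeries (dx_coef b p n t) x.

Lemma dxdt_bound (b : nat -> nat -> R -> R) (p n : nat) (x t : R) :
  (forall k n, Rabs (b k n t) <= weight (4 / 3) 6 1 k n) -> Rabs x <= 1 ->
  Rabs (dxdt b p n x t) <= 7 * coef_bound p n.
Proof.
intros h hx. unfold dxdt, PSeries.
assert (c := coef_bound_pos p n).
destruct (Series_bound (fun k => dx_coef b p n t k * x ^ k) (fun k => coef_bound p n * (6 / 7) ^ k))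
  as [_ E].
- intros k. rewrite Rabs_mult, <- RPow_abs, <- (Rmult_1_r (coef_bound _ _ * _)).
  apply Rmult_le_compat; [apply Rabs_pos|apply pow_le, Rabs_pos|apply dx_coef_bound, h|].
  rewrite <- (pow1 k). apply pow_incr; split; [apply Rabs_pos|exact hx].
- apply ex_series_geom_scal; lra.
- eapply Rle_trans; [exact E|]. rewrite Series_geom_scal by lra. right. field.
Qed.

Lemma dxdt_derive_x (b : nat -> nat -> R -> R) (p n : nat) (x t : R) :
  (forall k n, Rabs (b k n t) <= weight (4 / 3) 6 1 k n) -> Rabs x <= 1 ->
  is_derive (fun u => dxdt b p n u t) x (dxdt b (S p) n x t).
Proof.
intros h hx. unfold dxdt.
apply is_derive_eq with (PSeries (PS_derive (dx_coef b p n t)) x).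
- apply is_derive_PSeries. apply CV_radius_gt_1 with (coef_bound p n); [|exact hx].
  intros k. apply dx_coef_bound, h.
- apply PSeries_ext. intros k. unfold PS_derive, dx_coef.
  replace (k + S p)%nat with (S k + p)%nat by lia.
  rewrite (INR_fact_S k), S_INR.
  assert (q := INR_fact_pos k). assert (q' := pos_INR k). field. split; lra.
Qed.

Lemma dxdt_taylor_t (T : R) (b : nat -> nat -> R -> R) (p n : nat) (x : R) :
  (forall k, jets_on 0 T (b k)) ->
  (forall t, 0 <= t <= T -> forall k n, Rabs (b k n t) <= weight (4 / 3) 6 1 k n) -> Rabs x <= 1 ->
  unif_deriv 0 T (dxdt b p n x) (dxdt b p (S n) x).
Proof.
intros hj h hx.
assert (px : forall k, 0 <= Rabs (x ^ k) <= 1).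
{ intros k. split; [apply Rabs_pos|]. rewrite <- RPow_abs, <- (pow1 k).
  apply pow_incr; split; [apply Rabs_pos|exact hx]. }
exists (Series (fun k => coef_bound p (S (S n)) * (6 / 7) ^ k)).
unfold dxdt, PSeries.
apply taylor_on_series with (v := fun k => coef_bound p n * (6 / 7) ^ k)
  (w := fun k => coef_bound p (S n) * (6 / 7) ^ k);
  try (apply ex_series_geom_scal; lra).
- intros k t ht. rewrite Rabs_mult, <- (Rmult_1_r (coef_bound _ _ * _)).
  apply Rmult_le_compat; [apply Rabs_pos|apply px|apply dx_coef_bound; auto|apply px].
- intros k t ht. rewrite Rabs_mult, <- (Rmult_1_r (coef_bound _ _ * _)).
  apply Rmult_le_compat; [apply Rabs_pos|apply px|apply dx_coef_bound; auto|apply px].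
- intros k s t hs ht. unfold dx_coef.
  set (c := INR (fact (k + p)) / INR (fact k)).
  assert (hc : 0 < c) by (apply Rdiv_lt_0_compat; apply INR_fact_pos).
  replace (c * b (k + p)%nat n s * x ^ k - c * b (k + p)%nat n t * x ^ k -
    (s - t) * (c * b (k + p)%nat (S n) t * x ^ k)) with
    (c * (b (k + p)%nat n s - b (k + p)%nat n t - (s - t) * b (k + p)%nat (S n) t) * x ^ k) by ring.
  rewrite !Rabs_mult, (Rabs_pos_eq c) by lra.
  assert (E := jets_on_taylor 0 T _ (b (k + p)%nat) n (hj _)
    (fun t ht => h t ht (k + p)%nat (S (S n))) s t hs ht).
  apply Rle_trans with (c * (weight (4 / 3) 6 1 (k + p) (S (S n)) * (s - t) ^ 2) * 1).
  + apply Rmult_le_compat; [|apply px| |apply px].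
    * apply Rmult_le_pos; [lra|apply Rabs_pos].
    * apply Rmult_le_compat_l; [lra|exact E].
  + rewrite Rmult_1_r, <- Rmult_assoc. apply Rmult_le_compat_r; [apply pow2_ge_0|].
    apply dx_weight.
Qed.

(** Both sides are power series in x with the same coefficients, the product being
    a Cauchy product. *)
Lemma dxdt_pde (b : nat -> nat -> R -> R) (x t : R) :
  (forall k n, Rabs (b k n t) <= weight (4 / 3) 6 1 k n) ->
  ks_array (fun k n => b k n t) -> Rabs x <= 1 ->
  dxdt b 0 1 x t = - dxdt b 4 0 x t - dxdt b 2 0 x t - dxdt b 0 0 x t * dxdt b 1 0 x t.
Proof.
intros h hks hx. unfold dxdt.
assert (cv : forall p n, Rbar_lt (Rabs x) (CV_radius (dx_coef b p n t))).
{ intros p n. apply CV_radius_gt_1 with (coef_bound p n); [|exact hx].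
  intros k. apply dx_coef_bound, h. }
assert (ex : forall p n, ex_pseries (dx_coef b p n t) x) by (intros; apply CV_radius_inside, cv).
rewrite <- PSeries_mult by apply cv.
rewrite (PSeries_ext _ (PS_opp (PS_plus (PS_plus (dx_coef b 4 0 t) (dx_coef b 2 0 t))
   (PS_mult (dx_coef b 0 0 t) (dx_coef b 1 0 t))))).
- rewrite PSeries_opp, PSeries_plus, PSeries_plus; [ring|apply ex|apply ex| |].
  + apply (ex_pseries_plus (dx_coef b 4 0 t) (dx_coef b 2 0 t)); apply ex.
  + apply ex_pseries_mult; apply cv.
- intros k.
  change (dx_coef b 0 1 t k = - (dx_coef b 4 0 t k + dx_coef b 2 0 t k +
    sum_f_R0 (fun j => dx_coef b 0 0 t j * dx_coef b 1 0 t (k - j)) k)).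
  assert (q := INR_fact_pos k).
  assert (E0 : forall n j, dx_coef b 0 n t j = b j n t).
  { intros n j. unfold dx_coef. rewrite Nat.add_0_r. assert (q' := INR_fact_pos j). field; lra. }
  rewrite E0, hks. f_equal. unfold ks_lower.
  assert (E4 : dx_coef b 4 0 t k = rise4 k * b (k + 4)%nat 0%nat t).
  { unfold dx_coef. rewrite fact_plus4. field; lra. }
  assert (E2 : dx_coef b 2 0 t k = (INR k + 1) * (INR k + 2) * b (k + 2)%nat 0%nat t).
  { unfold dx_coef. replace (k + 2)%nat with (S (S k)) by lia.
    rewrite !INR_fact_S, S_INR. field; lra. }
  rewrite E4, E2, Rplus_assoc. f_equal. f_equal.
  apply sum_eq. intros j hj. rewrite E0. simpl leibniz. unfold dx_coef.
  replace (k - j + 1)%nat with (S (k - j)) by lia.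
  rewrite INR_fact_S, S_INR. assert (q' := INR_fact_pos (k - j)). field; lra.
Qed.

(** * Derivatives relative to an interval or a rectangle *)

Lemma is_derive_on_ext (a b : R) (f g : R -> R) (x l : R) :
  (forall u, a <= u <= b -> f u = g u) -> a <= x <= b ->
  is_derive_on a b f x l -> is_derive_on a b g x l.
Proof.
intros h hx [hl hd]. split; [exact hl|].
intros x' hx'.
assert (E := within_lim_unique a b x x' hx hx'). subst x'.
intros eps. generalize (hd x hx' eps). unfold within.
apply filter_imp. intros u hu huab. rewrite <- !h by assumption. apply hu, huab.
Qed.

Lemma Derive_on_eq (a b : R) (f g : R -> R) (x l : R) : a < b ->
  (forall u, a <= u <= b -> g u = f u) -> a <= x <= b ->
  is_derive_on a b g x l -> ex_derive_on a b f x /\ Derive_on a b f x = l.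
Proof.
intros hab h hx hd.
assert (hf := is_derive_on_ext a b g f x l h hx hd).
split; [exists l; exact hf|]. apply is_derive_on_unique; assumption.
Qed.

Lemma Rpower_4 (z : R) : 0 < z -> Rpower z 4 = z ^ 4.
Proof. intros hz. rewrite <- Rpower_pow by exact hz. f_equal. simpl; ring. Qed.

Lemma fact_4n_le (n : nat) : INR (fact (4 * n)) <= 256 ^ n * INR (fact n) ^ 4.
Proof.
assert (h1 := fact_add_le (2 * n) (2 * n)). assert (h2 := fact_add_le n n).
replace (2 * n + 2 * n)%nat with (4 * n)%nat in h1 by lia.
replace (n + n)%nat with (2 * n)%nat in h2 by lia.
rewrite pow_mult in h1, h2.
replace (2 ^ 4) with 16 in h1 by ring. replace (2 ^ 2) with 4 in h2 by ring.
eapply Rle_trans; [exact h1|].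
replace (256 ^ n) with (16 ^ n * (4 ^ n * 4 ^ n))
  by (rewrite <- !Rpow_mult_distr; f_equal; ring).
replace (16 ^ n * (4 ^ n * 4 ^ n) * INR (fact n) ^ 4) with
  (16 ^ n * ((4 ^ n * (INR (fact n) * INR (fact n))) * (4 ^ n * (INR (fact n) * INR (fact n)))))
  by ring.
apply Rmult_le_compat_l; [apply pow_le; lra|].
assert (q := INR_fact_pos (2 * n)). apply Rmult_le_compat; lra.
Qed.

(** (p+4n)! is at most p! (n!)^4 up to a geometric factor. *)
Lemma coef_bound_gevrey (p n : nat) :
  coef_bound p n <= INR (fact p) * INR (fact n) ^ 4 / ((/ 12) ^ p * (6 / 16777216) ^ n).
Proof.
unfold coef_bound.
assert (h1 := fact_add_le p (4 * n)). assert (h2 := fact_4n_le n).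
assert (q1 := INR_fact_pos p). assert (q2 := INR_fact_pos (4 * n)).
assert (p6 : 0 < 6 ^ n) by (apply pow_lt; lra).
assert (p16 : 0 < 16 ^ (p + 4 * n)) by (apply pow_lt; lra).
assert (p34 : 0 < (3 / 4) ^ p) by (apply pow_lt; lra).
apply Rle_trans with (16 ^ (p + 4 * n) * (INR (fact p) * (256 ^ n * INR (fact n) ^ 4)) * (3 / 4) ^ p / 6 ^ n).
- apply Rmult_le_compat_r; [left; apply Rinv_0_lt_compat; lra|].
  apply Rmult_le_compat_r; [lra|].
  apply Rle_trans with (2 ^ (p + 4 * n) * (INR (fact p) * INR (fact (4 * n))) * 8 ^ (p + 4 * n)).
  + apply Rmult_le_compat_r; [apply pow_le; lra|exact h1].
  + replace (16 ^ (p + 4 * n)) with (2 ^ (p + 4 * n) * 8 ^ (p + 4 * n)) in *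
      by (rewrite <- Rpow_mult_distr; f_equal; ring).
    replace (2 ^ (p + 4 * n) * (INR (fact p) * INR (fact (4 * n))) * 8 ^ (p + 4 * n)) with
      (2 ^ (p + 4 * n) * 8 ^ (p + 4 * n) * (INR (fact p) * INR (fact (4 * n)))) by ring.
    apply Rmult_le_compat_l; [lra|]. apply Rmult_le_compat_l; lra.
- right. rewrite pow_add, pow_mult. replace (16 ^ 4) with 65536 by ring.
  rewrite pow_inv. replace (12 ^ p) with (16 ^ p * (3 / 4) ^ p)
    by (rewrite <- Rpow_mult_distr; f_equal; field).
  replace ((6 / 16777216) ^ n) with (6 ^ n * / 16777216 ^ n)
    by (rewrite <- pow_inv, <- Rpow_mult_distr; f_equal; field).
  replace (16777216 ^ n) with (65536 ^ n * 256 ^ n) by (rewrite <- Rpow_mult_distr; f_equal; ring).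
  field. repeat split; apply pow_nonzero; lra.
Qed.

Lemma Gevrey_of_jets (T M r : R) (F : nat -> R -> R) : 0 < T -> 0 < M -> 0 < r ->
  jets_on 0 T F ->
  (forall p t, 0 <= t <= T -> Rabs (F p t) <= M * INR (fact p) ^ 4 / r ^ p) ->
  Gevrey 4 0 T (F 0%nat).
Proof.
intros hT hM hr hj hb.
assert (E : forall n t, 0 <= t <= T -> Derive_n_on 0 T n (F 0%nat) t = F n t /\
  ex_derive_on 0 T (Derive_n_on 0 T n (F 0%nat)) t).
{ induction n as [|n IH]; intros t ht.
  - split; [reflexivity|]. destruct (hj 0%nat) as [C hC].
    exists (F 1%nat t). apply (taylor_on_is_derive 0 T C); assumption.
  - assert (A : forall t, 0 <= t <= T -> Derive_n_on 0 T (S n) (F 0%nat) t = F (S n) t).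
    { intros u hu. destruct (hj n) as [C hC]. simpl.
      apply (Derive_on_eq 0 T _ (F n)); [exact hT| |exact hu|].
      - intros s hs. symmetry. apply (proj1 (IH s hs)).
      - apply (taylor_on_is_derive 0 T C); assumption. }
    split; [apply A, ht|].
    destruct (hj (S n)) as [C hC].
    apply (Derive_on_eq 0 T _ (F (S n)) t (F (S (S n)) t)); [exact hT| |exact ht|].
    + intros s hs. symmetry; apply A, hs.
    + apply (taylor_on_is_derive 0 T C); assumption. }
split.
- intros n t ht. apply E, ht.
- exists M, r. split; [exact hM|]. split; [exact hr|].
  intros p t ht. rewrite (proj1 (E p t ht)), Rpower_4 by apply INR_fact_pos. apply hb, ht.
Qed.

Definition derivative_family (T : R) (C : nat -> nat -> R) (Y : nat -> nat -> R -> R -> R) : Prop :=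
  (forall p n x t, 0 <= x <= 1 -> 0 <= t <= T ->
     is_derive (fun u => Y p n u t) x (Y (S p) n x t)) /\
  (forall p n x, 0 <= x <= 1 -> unif_deriv 0 T (Y p n x) (Y p (S n) x)) /\
  (forall p n x t, 0 <= x <= 1 -> 0 <= t <= T -> Rabs (Y p n x t) <= C p n).

Definition equal_on_rect (T : R) (z z' : R -> R -> R) : Prop :=
  forall x t, 0 <= x <= 1 -> 0 <= t <= T -> z x t = z' x t.

Lemma rect_D1 (T : R) (C : nat -> nat -> R) (Y : nat -> nat -> R -> R -> R)
  (p n : nat) (z : R -> R -> R) : 0 < T -> derivative_family T C Y ->
  equal_on_rect T z (Y p n) ->
  (forall x t, 0 <= x <= 1 -> 0 <= t <= T -> ex_derive_on 0 1 (fun u => z u t) x) /\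
  equal_on_rect T (D1_on 0 1 z) (Y (S p) n).
Proof.
intros hT [hx _] h.
split; intros x t i j;
  apply (Derive_on_eq 0 1 _ (fun u => Y p n u t) x (Y (S p) n x t)); try assumption; try lra;
  try (intros u hu; symmetry; apply h; assumption);
  (apply is_derive_on_derive; [exact i|apply hx; assumption]).
Qed.

Lemma rect_D2 (T : R) (C : nat -> nat -> R) (Y : nat -> nat -> R -> R -> R)
  (p n : nat) (z : R -> R -> R) : 0 < T -> derivative_family T C Y ->
  equal_on_rect T z (Y p n) ->
  (forall x t, 0 <= x <= 1 -> 0 <= t <= T -> ex_derive_on 0 T (fun u => z x u) t) /\
  equal_on_rect T (D2_on 0 T z) (Y p (S n)).
Proof.
intros hT [_ [ht _]] h.
split; intros x t i j; destruct (ht p n x i) as [K hK];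
  apply (Derive_on_eq 0 T _ (Y p n x) t (Y p (S n) x t)); try assumption;
  try (intros u hu; symmetry; apply h; assumption);
  (apply (taylor_on_is_derive 0 T K); assumption).
Qed.

(** Lipschitz in each variable, by the bounds on the next derivatives. *)
Lemma rect_continuous (T : R) (C : nat -> nat -> R) (Y : nat -> nat -> R -> R -> R)
  (p n : nat) (z : R -> R -> R) : derivative_family T C Y ->
  equal_on_rect T z (Y p n) ->
  continuous_on (rect 0 1 0 T) (fun q => z (fst q) (snd q)).
Proof.
intros [hx [ht hb]] h [x0 t0] [i j]. simpl in i, j.
apply filterlim_locally. intros eps.
assert (he := cond_pos eps).
assert (c1 : 0 <= C (S p) n) by (eapply Rle_trans; [apply Rabs_pos|apply (hb (S p) n x0 t0 i j)]).
assert (c2 : 0 <= C p (S n)) by (eapply Rle_trans; [apply Rabs_pos|apply (hb p (S n) x0 t0 i j)]).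
set (L := C (S p) n + C p (S n) + 1). assert (hL : 0 < L) by (unfold L; lra).
assert (hd : 0 < eps / L) by (apply Rdiv_lt_0_compat; assumption).
exists (mkposreal _ hd). intros [x t] [b1 b2] [i' j']. simpl in *.
change (Rabs (x - x0) < eps / L) in b1. change (Rabs (t - t0) < eps / L) in b2.
change (Rabs (z x t - z x0 t0) < eps). rewrite !h by assumption.
replace (Y p n x t - Y p n x0 t0) with ((Y p n x t - Y p n x0 t) + (Y p n x0 t - Y p n x0 t0)) by ring.
eapply Rle_lt_trans; [apply Rabs_triang|].
assert (e2 : Rabs (Y p n x0 t - Y p n x0 t0) <= C p (S n) * Rabs (t - t0)).
{ apply (unif_deriv_lipschitz 0 T _ _ _ (ht p n x0 i)); auto. }
assert (e1 : Rabs (Y p n x t - Y p n x0 t) <= C (S p) n * Rabs (x - x0)).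
{ assert (m1 : 0 <= Rmin x0 x) by (apply Rmin_glb; lra).
  assert (m2 : Rmax x0 x <= 1) by (apply Rmax_lub; lra).
  destruct (MVT_is_derive (fun u => Y p n u t) (fun u => Y (S p) n u t) x x0) as [c [hc E]].
  - intros u hu. apply hx; [lra|exact j'].
  - rewrite E, Rabs_mult. apply Rmult_le_compat_r; [apply Rabs_pos|].
    apply hb; [lra|exact j']. }
apply Rle_lt_trans with ((C (S p) n + C p (S n)) * (eps / L)).
- rewrite Rmult_plus_distr_r. apply Rplus_le_compat.
  + eapply Rle_trans; [exact e1|]. apply Rmult_le_compat_l; lra.
  + eapply Rle_trans; [exact e2|]. apply Rmult_le_compat_l; lra.
- apply Rlt_le_trans with (L * (eps / L)).
  + apply Rmult_lt_compat_r; [exact hd|unfold L; lra].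
  + right; field; lra.
Qed.

(** The statement is for any function that agrees with a member of the family on the
    rectangle, because the derivatives relative to the intervals are only known there. *)
Lemma rect_smooth (T : R) (C : nat -> nat -> R) (Y : nat -> nat -> R -> R -> R)
  (N : nat) : 0 < T -> derivative_family T C Y -> forall (p n : nat) (z : R -> R -> R),
  equal_on_rect T z (Y p n) -> C_n_rect 0 1 0 T N z.
Proof.
intros hT hY. induction N as [|N IH]; intros p n z h; simpl;
  (split; [exact (rect_continuous T C Y p n z hY h)|]); [exact I|].
destruct (rect_D1 T C Y p n z hT hY h) as [e1 d1].
destruct (rect_D2 T C Y p n z hT hY h) as [e2 d2].
split; [|split].
- intros x t i j. split; [apply e1|apply e2]; assumption.
- exact (IH (S p) n _ d1).
- exact (IH p (S n) _ d2).
Qed.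

Lemma rect_D1_n (T : R) (C : nat -> nat -> R) (Y : nat -> nat -> R -> R -> R)
  (k p n : nat) (z : R -> R -> R) : 0 < T -> derivative_family T C Y ->
  equal_on_rect T z (Y p n) ->
  equal_on_rect T (D1_n_on 0 1 k z) (Y (k + p)%nat n).
Proof.
intros hT hY h. induction k as [|k IH]; [exact h|].
exact (proj2 (rect_D1 T C Y (k + p) n _ hT hY IH)).
Qed.

Lemma rect_D2_n (T : R) (C : nat -> nat -> R) (Y : nat -> nat -> R -> R -> R)
  (k p n : nat) (z : R -> R -> R) : 0 < T -> derivative_family T C Y ->
  equal_on_rect T z (Y p n) ->
  equal_on_rect T (D2_n_on 0 T k z) (Y p (k + n)%nat).
Proof.
intros hT hY h. induction k as [|k IH]; [exact h|].
exact (proj2 (rect_D2 T C Y p (k + n) _ hT hY IH)).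
Qed.

(** * Jets of the initial and final states *)

(** The series of z(x) and of - z(-x) have the same coefficients. *)
Lemma odd_coef_zero (A c : R) (alpha : nat -> R) (z : R -> R) : 1 < A ->
  (forall k, Rabs (alpha k) <= c / A ^ k) ->
  (forall x, -1 <= x <= 1 -> is_pseries alpha x (z x)) -> odd_on_sym z ->
  forall k, Nat.Even k -> alpha k = 0.
Proof.
intros hA hb hz ho k hk.
assert (hc : 0 <= c).
{ assert (q := hb 0%nat). simpl in q. assert (q' := Rabs_pos (alpha 0%nat)). lra. }
set (beta := fun k => - ((-1) ^ k * alpha k)).
assert (hcv : forall a : nat -> R, (forall k, Rabs (a k) <= c / A ^ k) -> Rbar_lt 0 (CV_radius a)).
{ intros a ha. apply Rbar_lt_le_trans with 1; [simpl; lra|].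
  apply (proj1 (CV_radius_bounded a)). exists c. intros n. rewrite pow1, Rmult_1_r.
  eapply Rle_trans; [apply ha|].
  assert (1 <= A ^ n) by (apply pow_R1_Rle; lra).
  unfold Rdiv. rewrite <- (Rmult_1_r c) at 2. apply Rmult_le_compat_l; [exact hc|].
  rewrite <- Rinv_1. apply Rinv_le_contravar; lra. }
assert (E : alpha k = beta k).
{ apply PSeries_ext_recip.
  - apply hcv, hb.
  - apply hcv. intros n. unfold beta. rewrite Rabs_Ropp, Rabs_mult, pow_1_abs, Rmult_1_l. apply hb.
  - exists (mkposreal 1 Rlt_0_1). intros x hx.
    change (Rabs (x - 0) < 1) in hx. rewrite Rminus_0_r in hx. apply Rabs_def2 in hx.
    rewrite (is_pseries_unique _ _ _ (hz x ltac:(lra))).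
    replace (z x) with (- z (- x)) by (rewrite ho by lra; ring).
    rewrite <- (is_pseries_unique _ _ _ (hz (- x) ltac:(lra))).
    unfold PSeries. rewrite <- Series_opp. apply Series_ext. intros n. unfold beta.
    replace (- x) with (-1 * x) by ring. rewrite Rpow_mult_distr. ring. }
unfold beta in E. destruct hk as [l ->]. rewrite pow_1_even in E. lra.
Qed.

Lemma R_hat_ge_16 : 16 <= R_hat.
Proof.
unfold R_hat. assert (q := exp_pos 1).
assert (p : 0 < / (4 * exp 1)) by (apply Rinv_0_lt_compat; lra).
assert (h := exp_ineq1 (/ (4 * exp 1)) ltac:(lra)). lra.
Qed.

(** [d] collects the time derivatives, at the time when the state is z, of the
    coefficients of an odd solution; only the rows of x and x^3 need bounds. *)
Definition taylor_state (z : R -> R) (c : R) (d : nat -> nat -> R) : Prop :=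
  ks_array d /\ (forall n, d 0%nat n = 0) /\ (forall n, d 2%nat n = 0) /\
  (forall x, 0 <= x <= 1 -> PSeries (fun k => d k 0%nat) x = z x) /\
  (forall n, Rabs (d 1%nat n) <= c * INR (fact (4 * n + 3)) / 2048 ^ n) /\
  (forall n, Rabs (d 3%nat n) <= c * INR (fact (4 * n + 3)) / 2048 ^ n).

(** [ks_bound_t] with A = 16, B = 2048: for M = 1/40,
    1/4096 + 1/192 + 1/480 < 1/128. *)
Lemma state_jets (r c : R) (z : R -> R) : 16 <= r -> 0 <= c <= 1 / 40 ->
  in_class_R r c z -> odd_on_sym z -> exists d, taylor_state z c d.
Proof.
intros hr hc [alpha [ha hz]] ho.
set (al := fun k => alpha k / INR (fact k)) in *.
assert (hal : forall k, Rabs (al k) <= c / 16 ^ k).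
{ intros k. unfold al. assert (q := INR_fact_pos k).
  unfold Rdiv. rewrite Rabs_mult, (Rabs_pos_eq (/ _)) by (left; apply Rinv_0_lt_compat; lra).
  assert (p16 : 0 < 16 ^ k) by (apply pow_lt; lra).
  assert (pr : 16 ^ k <= r ^ k) by (apply pow_incr; lra).
  apply Rle_trans with (c * INR (fact k) / r ^ k * / INR (fact k)).
  - apply Rmult_le_compat_r; [left; apply Rinv_0_lt_compat; lra|apply ha].
  - replace (c * INR (fact k) / r ^ k * / INR (fact k)) with (c * / r ^ k) by (field; split; lra).
    apply Rmult_le_compat_l; [lra|]. apply Rinv_le_contravar; lra. }
assert (he := odd_coef_zero 16 c al z ltac:(lra) hal hz ho).
set (d := initial_jets al).
assert (hks : ks_array d) by apply initial_jets_ks.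
assert (hev : forall n k, Nat.Even k -> d k n = 0) by (apply initial_jets_even, he).
assert (hbd : forall n k, Rabs (d k n) <= weight 16 2048 c k n).
{ apply ks_bound_t; try lra.
  - exact hks.
  - intros n. apply hev. exists 0%nat; reflexivity.
  - intros k. unfold d. rewrite initial_jets_0. eapply Rle_trans; [apply hal|].
    right. unfold weight. rewrite Nat.mul_0_r, Nat.add_0_r. simpl (2048 ^ 0).
    assert (q := INR_fact_pos k). field. split; (lra || (apply pow_nonzero; lra)). }
assert (p2 : forall n, 0 < / 2048 ^ n) by (intros; apply Rinv_0_lt_compat, pow_lt; lra).
exists d. split; [exact hks|]. split; [|split; [|split; [|split]]].
- intros n. apply hev. exists 0%nat; reflexivity.
- intros n. apply hev. exists 1%nat; reflexivity.
- intros x hx. apply is_pseries_unique.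
  apply hz; lra.
- intros n. eapply Rle_trans; [apply hbd|]. unfold weight.
  assert (f := INR_fact_pos (1 + 4 * n)).
  assert (f' : INR (fact (1 + 4 * n)) <= INR (fact (4 * n + 3))).
  { apply le_INR, fact_le; lia. }
  change (fact 1) with 1%nat. simpl (INR 1).
  replace (c * INR (fact (1 + 4 * n)) / (1 * 16 ^ 1 * 2048 ^ n)) with
    (c * (INR (fact (1 + 4 * n)) / 16) * / 2048 ^ n) by (field; apply pow_nonzero; lra).
  apply Rmult_le_compat_r; [left; apply p2|]. apply Rmult_le_compat_l; [lra|]. lra.
- intros n. eapply Rle_trans; [apply hbd|]. unfold weight.
  rewrite (Nat.add_comm 3). assert (f := INR_fact_pos (4 * n + 3)).
  change (fact 3) with 6%nat. replace (INR 6) with 6 by (simpl; ring).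
  replace (c * INR (fact (4 * n + 3)) / (6 * 16 ^ 3 * 2048 ^ n)) with
    (c * (INR (fact (4 * n + 3)) / (6 * 16 ^ 3)) * / 2048 ^ n) by (field; apply pow_nonzero; lra).
  apply Rmult_le_compat_r; [left; apply p2|]. apply Rmult_le_compat_l; lra.
Qed.

(** At that time the coefficients produced in x and the jets [d] obey the same recursion
    and agree in the rows 0, 1, 2, 3. *)
Lemma lateral_state (z : R -> R) (c t : R) (d : nat -> nat -> R) (g1 g3 : nat -> R -> R) :
  taylor_state z c d -> (forall n, g1 n t = d 1%nat n) -> (forall n, g3 n t = d 3%nat n) ->
  forall x, 0 <= x <= 1 -> dxdt (lateral g1 g3) 0 0 x t = z x.
Proof.
intros [hks [h0 [h2 [hz _]]]] e1 e3 x hx.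
rewrite <- hz by exact hx. unfold dxdt. apply PSeries_ext. intros k.
unfold dx_coef. rewrite Nat.add_0_r.
rewrite (ks_array_unique (fun k n => lateral g1 g3 k n t) d (lateral_ks g1 g3 t) hks).
- assert (q := INR_fact_pos k). field; lra.
- intros j n hj. destruct j as [|[|[|[|j]]]]; [| | | |lia].
  + rewrite h0. reflexivity.
  + exact (e1 n).
  + rewrite h2. reflexivity.
  + exact (e3 n).
Qed.

Theorem theorem2p7 (r T : R) (hr : r > R_hat) (hT : T > 0) :
  exists c_hat : R, c_hat > 0 /\
  forall y0 yT : R -> R,
    in_class_R r c_hat y0 -> odd_on_sym y0 ->
    in_class_R r c_hat yT -> odd_on_sym yT ->
  exists (y : R -> R -> R) (v w : R -> R),
    Gevrey2 1 4 0 1 0 T y /\ Gevrey 4 0 T v /\ Gevrey 4 0 T w /\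
    (forall x t : R, 0 <= x <= 1 -> 0 <= t <= T ->
       D2_on 0 T y x t =
       - D1_n_on 0 1 4 y x t - D1_n_on 0 1 2 y x t - y x t * D1_on 0 1 y x t) /\
    (forall t : R, 0 <= t <= T ->
       y 0 t = 0 /\ y 1 t = v t /\
       D1_n_on 0 1 2 y 0 t = 0 /\ D1_n_on 0 1 2 y 1 t = w t) /\
    (forall x : R, 0 <= x <= 1 -> y x 0 = y0 x) /\
    (forall x : R, 0 <= x <= 1 -> y x T = yT x).
Proof.
apply Rgt_lt in hT.
assert (hr16 : 16 <= r) by (assert (q := R_hat_ge_16); lra).
destruct (borel_two_point T hT) as [K [hK hB]].
(* 1/40 is what [state_jets] needs; K c <= 27/64 is what [lateral_bound] needs. *)
set (c := Rmin (1 / 40) (27 / 64 / K)).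
assert (hKi : 0 < 27 / 64 / K) by (apply Rdiv_lt_0_compat; lra).
assert (c0 : 0 < c) by (apply Rmin_glb_lt; lra).
assert (c1 := Rmin_l (1 / 40) (27 / 64 / K)). assert (c2 := Rmin_r (1 / 40) (27 / 64 / K)).
fold c in c1, c2.
assert (cK : K * c <= 27 / 64).
{ apply (Rmult_le_compat_l K) in c2; [|lra].
  replace (K * (27 / 64 / K)) with (27 / 64) in c2 by (field; lra). exact c2. }
exists c. split; [exact c0|].
intros y0 yT h0 o0 hTc oT.
destruct (state_jets r c y0 hr16 ltac:(lra) h0 o0) as [d sd].
destruct (state_jets r c yT hr16 ltac:(lra) hTc oT) as [d' sd'].
assert (sd_ := sd). assert (sd'_ := sd').
destruct sd_ as [_ [_ [_ [_ [b1 b3]]]]]. destruct sd'_ as [_ [_ [_ [_ [b1' b3']]]]].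
destruct (hB c (d 1%nat) (d' 1%nat) ltac:(lra) b1 b1') as [g1 [j1 [m1 [z1 t1]]]].
destruct (hB c (d 3%nat) (d' 3%nat) ltac:(lra) b3 b3') as [g3 [j3 [m3 [z3 t3]]]].
assert (up : forall n, K * c * INR (fact (4 * n)) / 6 ^ n <= 27 / 64 * INR (fact (4 * n)) / 6 ^ n).
{ intros n. assert (q := INR_fact_pos (4 * n)).
  apply Rmult_le_compat_r; [left; apply Rinv_0_lt_compat, pow_lt; lra|].
  apply Rmult_le_compat_r; lra. }
set (b := lateral g1 g3).
assert (jb : forall k, jets_on 0 T (b k)) by (apply lateral_jets; [lra|exact j1|exact j3]).
assert (bb : forall t, 0 <= t <= T -> forall k n, Rabs (b k n t) <= weight (4 / 3) 6 1 k n).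
{ intros t ht. apply lateral_bound; intros n; (eapply Rle_trans; [|apply up]);
    [apply m1|apply m3]; exact ht. }
set (Y := dxdt b).
assert (ax : forall x, 0 <= x <= 1 -> Rabs x <= 1) by (intros; rewrite Rabs_pos_eq; lra).
assert (hx : forall p n x t, 0 <= x <= 1 -> 0 <= t <= T ->
  is_derive (fun u => Y p n u t) x (Y (S p) n x t))
  by (intros; apply dxdt_derive_x; auto).
assert (ht : forall p n x, 0 <= x <= 1 -> unif_deriv 0 T (Y p n x) (Y p (S n) x))
  by (intros; apply dxdt_taylor_t; auto).
assert (hb : forall p n x t, 0 <= x <= 1 -> 0 <= t <= T -> Rabs (Y p n x t) <= 7 * coef_bound p n)
  by (intros; apply dxdt_bound; auto).
assert (hg : forall p n x t, 0 <= x <= 1 -> 0 <= t <= T -> Rabs (Y p n x t) <=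
  7 * INR (fact p) * INR (fact n) ^ 4 / ((/ 12) ^ p * (6 / 16777216) ^ n)).
{ intros p n x t i j. eapply Rle_trans; [apply hb; assumption|].
  unfold Rdiv. rewrite !Rmult_assoc. apply Rmult_le_compat_l; [lra|].
  rewrite <- Rmult_assoc. apply coef_bound_gevrey. }
assert (hgv : forall p, Gevrey 4 0 T (Y p 0%nat 1)).
{ intros p.
  assert (pp : 0 < (/ 12) ^ p) by (apply pow_lt; lra).
  assert (pf := INR_fact_pos p).
  apply (Gevrey_of_jets T (7 * INR (fact p) / (/ 12) ^ p) (6 / 16777216) (fun n => Y p n 1)); try lra.
  - apply Rdiv_lt_0_compat; lra.
  - intros n. apply ht; lra.
  - intros n t i. eapply Rle_trans; [apply hg; [lra|exact i]|]. right.
    field. split; (lra || (apply pow_nonzero; lra)). }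
set (C := fun p n => 7 * coef_bound p n).
assert (hY : derivative_family T C Y) by (split; [exact hx|split; [exact ht|exact hb]]).
assert (Ye : equal_on_rect T (Y 0%nat 0%nat) (Y 0%nat 0%nat)) by (intros x t _ _; reflexivity).
assert (D1n := fun k => rect_D1_n T C Y k 0 0 (Y 0%nat 0%nat) hT hY Ye).
assert (D2n := fun k => rect_D2_n T C Y k 0 0 (Y 0%nat 0%nat) hT hY Ye).
exists (Y 0%nat 0%nat), (Y 0%nat 0%nat 1), (Y 2%nat 0%nat 1).
split; [|split; [apply hgv|split; [apply hgv|split; [|split; [|split]]]]].
- split.
  + intros N. exact (rect_smooth T C Y N hT hY 0 0 _ Ye).
  + exists 7, (/ 12), (6 / 16777216). split; [lra|]. split; [lra|]. split; [lra|].
    intros p n x t i j.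
    specialize (D2n n). rewrite Nat.add_0_r in D2n.
    rewrite (rect_D1_n T C Y p 0 n _ hT hY D2n x t i j).
    rewrite Nat.add_0_r, Rpower_1, Rpower_4 by apply INR_fact_pos. apply hg; assumption.
- intros x t i j.
  rewrite (proj2 (rect_D2 T C Y 0 0 _ hT hY Ye) x t i j), !D1n by assumption.
  rewrite (proj2 (rect_D1 T C Y 0 0 _ hT hY Ye) x t i j).
  apply dxdt_pde; [apply bb, j|apply lateral_ks|apply ax, i].
- intros t j.
  assert (at0 : forall p, Y p 0%nat 0 t = dx_coef b p 0 t 0%nat).
  { intros p. unfold Y, dxdt. apply PSeries_0. }
  split; [|split; [reflexivity|split]].
  + rewrite at0. unfold dx_coef. change (b (0 + 0)%nat 0%nat t) with 0. ring.
  + rewrite D1n by (assumption || lra). simpl Nat.add. rewrite at0. unfold dx_coef.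
    change (b (0 + 2)%nat 0%nat t) with 0. ring.
  + apply D1n; [lra|exact j].
- apply (lateral_state y0 c 0 d g1 g3 sd); assumption.
- apply (lateral_state yT c T d' g1 g3 sd'); assumption.
Qed.
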